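(* In the setting where delays are available at action time, the expected regret of Skipper$(\beta,\mathrm{DEW}(\eta,\beta))$ tuned by the scheme Doubling (see context) satisfies, for every $T$ and without prior knowledge of $T$ or $D$, $$\bar{\mathcal R}_T\le 15\min_{\beta>0}\left\{|S_\beta|+4e\beta\ln K+\frac{KT+D_\beta}{4e\beta}\right\}+10e^2K\ln K+5.$$
   Context: Setting: fix integers $K\ge 2$, $T\ge 1$, $[K]=\{1,\dots,K\}$. An oblivious adversary fixes in advance losses $\ell_t^a\in[0,1]$ and nonnegative integer delays $d_t$. In each round $t$ the delay $d_t$ is revealed to the learner at the beginning of the round (delay available at action time); the learner then picks (possibly at random) $A_t\in[K]$, suffers $\ell_t^{A_t}$, and at the end of round $t$ observes the pairs $(s,\ell_s^{A_s})$ for all $s\le t$ with $s+d_s=t$. Expected regret: $\bar{\mathcal R}_T=\mathbb E[\sum_{t=1}^T\ell_t^{A_t}]-\min_a\sum_{t=1}^T\ell_t^a$. $D=\sum_{t=1}^Td_t$, $S_\beta=\{t\in[T]:d_t\ge\beta\}$, $D_\beta=\sum_{t\in[T]\setminus S_\beta}d_t$. Algorithm DEW with inputs $\eta>0$ and $d_{\max}$: $\eta'=\min\{\eta,(4e\,d_{\max})^{-1}\}$, $w_0^a=1$; in round $t$ play $A_t\sim p_t$ with $p_t^a=w_{t-1}^a/\sum_b w_{t-1}^b$; at the end of the round, for each received pair $(s,\ell_s^{A_s})$ form $\hat\ell_s^a=\ell_s^a\mathbb 1(a=A_s)/p_s^a$ and update $w_t^a=w_{t-1}^a\exp(-\eta'\sum_s\hat\ell_s^a)$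 (sum over pairs received in round $t$). Skipper$(\beta,\mathcal A)$ plays the actions of the base algorithm $\mathcal A$ and forwards to $\mathcal A$ only the pairs $(s,\ell_s^{A_s})$ with $d_s<\beta$. Skipper$(\beta,\mathrm{DEW}(\eta,\beta))$ uses DEW with learning rate $\eta$ and $d_{\max}=\beta$. Doubling: rounds are partitioned into consecutive epochs indexed by $m$, with $\omega_m=2^m$, $\beta_m=\sqrt{\omega_m}/(4e\ln K)$ and $\eta_m=1/(4e\beta_m)$; in each epoch a fresh copy of Skipper$(\beta_m,\mathrm{DEW}(\eta_m,\beta_m))$ is run. For epoch $m$ let $\sigma(m)$ be its number of rounds, $S^m_\beta$ the set of its rounds with $d_t\ge\beta$, and $D^m_\beta$ the sum of $d_t$ over its rounds with $d_t<\beta$. At the beginning of each round $t$, after $d_t$ is revealed, the algorithm stays in the current epoch $m$ if, with round $t$ included in epoch $m$, $$\max\Big\{|S^m_{\beta_m}|^2,\ \Big(\tfrac{eK\sigma(m)}{2}+D^m_{\beta_m}\Big)\ln K\Big\}\le\omega_m;$$ otherwise a new epoch (with a larger index) is started at round $t$, before $A_t$ is selected. *)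

(* Defs.v *)
From Stdlib Require Import Reals Arith Bool.
Open Scope R_scope.

(* Rounds are 1..T, actions are 0..K-1. *)

Fixpoint sumR (n : nat) (f : nat -> R) : R :=
  match n with O => 0 | S n' => sumR n' f + f n' end.

Fixpoint minR (n : nat) (f : nat -> R) : R :=
  match n with
  | O => 0
  | S O => f O
  | S n' => Rmin (minR n' f) (f n')
  end.

Definition leb_R (x y : R) : bool := if Rle_dec x y then true else false.
Definition ltb_R (x y : R) : bool := if Rlt_dec x y then true else false.

Definition omega (m : nat) : R := 2 ^ m.
Definition beta_m (K m : nat) : R := sqrt (omega m) / (4 * exp 1 * ln (INR K)).
Definition eta_m (K m : nat) : R := 1 / (4 * exp 1 * beta_m K m).
(* DEW(eta_m, d_max = beta_m): eta' = min(eta, 1/(4 e d_max)) *)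
Definition eta'_m (K m : nat) : R := Rmin (eta_m K m) (/ (4 * exp 1 * beta_m K m)).

(* d < beta_m : round is forwarded by Skipper(beta_m, .) *)
Definition isSmall (K m d : nat) : bool := ltb_R (INR d) (beta_m K m).

(* the epoch-stay condition, for epoch index m with sigma rounds,
   |S^m| = s and D^m = D *)
Definition cond (K m sigma s D : nat) : bool :=
  leb_R (Rmax (INR s ^ 2) ((exp 1 * INR K * INR sigma / 2 + INR D) * ln (INR K)))
        (omega m).

(* statistics (|S|, D) of an epoch with index m consisting of one round with delay d *)
Definition s1 (K m d : nat) : nat := if isSmall K m d then 0%nat else 1%nat.
Definition D1 (K m d : nat) : nat := if isSmall K m d then d else 0%nat.

Fixpoint search (K d m fuel : nat) : nat :=
  match fuel with
  | O => m
  | S f => if cond K m 1 (s1 K m d) (D1 K m d) then m else search K d (S m) f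
  end.

(* Index of the new epoch: the smallest m' > m such that the condition holds
   for the new epoch (consisting of the current round only).  The search bound
   (2K+d)K is always sufficient, so this is the true minimum. *)
Definition next_index (K m d : nat) : nat := search K d (S m) ((2 * K + d) * K).

(* State after processing rounds 1..t: (epoch index, sigma, |S|, D) of current epoch *)
Fixpoint estate (K : nat) (dl : nat -> nat) (t : nat) : nat * nat * nat * nat :=
  match t with
  | O => (0, 0, 0, 0)%nat
  | S t' =>
      let '(m, sg, s, D) := estate K dl t' in
      let d := dl (S t') in
      let s' := (s + s1 K m d)%nat in
      let D' := (D + D1 K m d)%nat in
      if cond K m (S sg) s' D' then (m, S sg, s', D')
      else let m' := next_index K m d in (m', 1%nat, s1 K m' d, D1 K m' d)
  end.

Definition epoch (K : nat) (dl : nat -> nat) (t : nat) : nat :=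
  fst (fst (fst (estate K dl t))).

Section Alg.
Variables (K : nat) (dl : nat -> nat) (loss : nat -> nat -> R).

(* Cumulative importance-weighted loss of action a fed to the DEW copy of the
   epoch of round t before round t: rounds s of the same epoch, with d_s < beta,
   whose feedback arrived at the end of some round <= t-1 (s + d_s <= t-1).
   A : actions played, P s b : probability of b in round s. *)
Definition cumloss (A : nat -> nat) (P : nat -> nat -> R) (t a : nat) : R :=
  sumR t (fun s =>
    if (1 <=? s)%nat && (epoch K dl s =? epoch K dl t)%nat
       && isSmall K (epoch K dl t) (dl s) && (s + dl s <=? t - 1)%nat
    then (if (A s =? a)%nat then loss s a / P s a else 0)
    else 0).

Definition weight A P t a : R := exp (- eta'_m K (epoch K dl t) * cumloss A P t a).

Definition pdist A P t a : R := weight A P t a / sumR K (fun b => weight A P t b).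

(* pvec A t s a = p_s^a for s <= t (given actions A) *)
Fixpoint pvec (A : nat -> nat) (t : nat) : nat -> nat -> R :=
  match t with
  | O => fun _ _ => 0
  | S t' => let P := pvec A t' in
            fun s => if (s =? S t')%nat then (fun a => pdist A P (S t') a) else P s
  end.

(* expected loss of rounds t..t+k-1 given actions A before t *)
Fixpoint ev (k t : nat) (A : nat -> nat) : R :=
  match k with
  | O => 0
  | S k' => sumR K (fun a =>
      let A' := fun s => if (s =? t)%nat then a else A s in
      pvec A' t t a * (loss t a + ev k' (S t) A'))
  end.

End Alg.

Definition exp_regret (K T : nat) (dl : nat -> nat) (loss : nat -> nat -> R) : R :=
  ev K dl loss T 1 (fun _ => 0%nat) - minR K (fun a => sumR T (fun i => loss (S i) a)).

Definition card_S (T : nat) (dl : nat -> nat) (beta : R) : R :=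
  sumR T (fun i => if Rle_dec beta (INR (dl (S i))) then 1 else 0).
Definition D_beta (T : nat) (dl : nat -> nat) (beta : R) : R :=
  sumR T (fun i => if Rlt_dec (INR (dl (S i))) beta then INR (dl (S i)) else 0).

(* Main.v *)
Require Import Defs.
From Stdlib Require Import Reals Lra Lia Arith Bool List FunctionalExtensionality.
Open Scope R_scope.

(* Within an epoch, order the forwarded feedback by arrival and process it one item at a
   time. The exponential-weights bound then holds for the distributions q_s in use just
   before the feedback of round s is processed. The feedback processed between the choice
   of p_s and the use of q_s comes from fewer than 2 beta rounds, so q_s <= e p_s, and
   q_s >= p_s (1 - eta * (estimates in between)); summed over s, the number of estimates in
   between is at most the total delay. As A_s influences nothing before its feedback
   arrives, the estimates integrate to the true losses, and an epoch of index m costs at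
   most |S| + ln K / eta + eta (e K sigma / 2 + D) <= 3 * 2^(m/2).

   After the first epoch the index grows by exactly one, so the epochs up to M cost at most
   3 * sum_(m <= M) 2^(m/2) <= 15 * 2^((M-1)/2), and the violation which closed epoch M - 1
   forces the minimized expression to be at least 2^((M-1)/2) for every beta. A run
   consisting of a single epoch is covered by the additive terms. *)

(** * Finite sums and elementary inequalities *)

(** The estimates are as large as [1 / p], so the drift between [p_s] and [q_s] cannot be controlled
    one estimate at a time. What is bounded is [p_s * est_loss], at most 1 and supported on the
    played action. Hence [q_s <= e p_s] is proved by strong induction on the processing order: for
    an item processed earlier, the same bound makes the mean of its estimate at most [e], which
    limits the loss of total weight. The factor [4 e] in the learning rate closes the induction: as
    [eta e = 1 / (4 beta)], one item multiplies the total weight by at least [exp (- 1 / (2 beta))],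
    and [2 beta] items by at least [1 / e].

    Independence is expressed without filtrations. Expectations are iterated finite sums over
    actions, and a quantity counts as independent of the action of round [s] when overwriting that
    action by [upd] leaves it unchanged. This lets both importance weights of a cross term between
    two rounds cancel in expectation. *)

Lemma sumR_ext (n : nat) (f g : nat -> R) :
  (forall i, (i < n)%nat -> f i = g i) -> sumR n f = sumR n g.
Proof.
  induction n as [|n IH]; intros H; simpl; [reflexivity|].
  rewrite IH, H by (intros; try apply H; lia); reflexivity.
Qed.

Lemma sumR_le (n : nat) (f g : nat -> R) :
  (forall i, (i < n)%nat -> f i <= g i) -> sumR n f <= sumR n g.
Proof.
  induction n as [|n IH]; intros H; simpl; [lra|].
  apply Rplus_le_compat; [apply IH; intros; apply H; lia | apply H; lia].
Qed.

Lemma sumR_const (n : nat) (c : R) : sumR n (fun _ => c) = INR n * c.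
Proof.
  induction n as [|n IH]; [simpl; ring|].
  rewrite S_INR; simpl; rewrite IH; ring.
Qed.

Lemma sumR_0 (n : nat) (f : nat -> R) :
  (forall i, (i < n)%nat -> f i = 0) -> sumR n f = 0.
Proof.
  intros H; rewrite (sumR_ext n f (fun _ => 0)) by exact H.
  rewrite sumR_const; ring.
Qed.

Lemma sumR_ge0 (n : nat) (f : nat -> R) :
  (forall i, (i < n)%nat -> 0 <= f i) -> 0 <= sumR n f.
Proof.
  intros H; rewrite <- (sumR_0 n (fun _ => 0)) by reflexivity.
  now apply sumR_le.
Qed.

Lemma sumR_plus (n : nat) (f g : nat -> R) :
  sumR n (fun i => f i + g i) = sumR n f + sumR n g.
Proof. induction n as [|n IH]; simpl; [ring | rewrite IH; ring]. Qed.

Lemma sumR_minus (n : nat) (f g : nat -> R) :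
  sumR n (fun i => f i - g i) = sumR n f - sumR n g.
Proof. induction n as [|n IH]; simpl; [ring | rewrite IH; ring]. Qed.

Lemma sumR_scal (n : nat) (c : R) (f : nat -> R) :
  sumR n (fun i => c * f i) = c * sumR n f.
Proof. induction n as [|n IH]; simpl; [ring | rewrite IH; ring]. Qed.

Lemma sumR_swap (n m : nat) (f : nat -> nat -> R) :
  sumR n (fun i => sumR m (fun j => f i j)) =
  sumR m (fun j => sumR n (fun i => f i j)).
Proof.
  induction n as [|n IH]; simpl.
  - symmetry; now apply sumR_0.
  - now rewrite IH, sumR_plus.
Qed.

Lemma sumR_S_l (n : nat) (f : nat -> R) :
  sumR (S n) f = f O + sumR n (fun i => f (S i)).
Proof. induction n as [|n IH]; [simpl; ring|]. simpl in *; rewrite IH; ring. Qed.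

Lemma sumR_delta (n i : nat) (f : nat -> R) : (i < n)%nat ->
  sumR n (fun j => if (j =? i)%nat then f j else 0) = f i.
Proof.
  induction n as [|n IH]; intros Hi; [lia|]; simpl.
  destruct (Nat.eqb_spec n i) as [->|Hne].
  - rewrite sumR_0; [ring|].
    intros j Hj; destruct (Nat.eqb_spec j i); [lia|reflexivity].
  - rewrite IH by lia; ring.
Qed.

Lemma sumR_term_le (n i : nat) (f : nat -> R) :
  (i < n)%nat -> (forall j, (j < n)%nat -> 0 <= f j) -> f i <= sumR n f.
Proof.
  intros Hi Hf; rewrite <- (sumR_delta n i f) by exact Hi.
  apply sumR_le; intros j Hj.
  destruct (Nat.eqb_spec j i); [lra | now apply Hf].
Qed.

Lemma sumR_interval_le (n lo hi : nat) :
  sumR n (fun i => if ((lo <=? i) && (i <? hi))%nat then 1 else 0) <= INR (hi - lo).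
Proof.
  assert (H : sumR n (fun i => if ((lo <=? i) && (i <? hi))%nat then 1 else 0)
              <= INR (Nat.min n hi - lo)).
  { induction n as [|n IH]; [cbn [sumR]; apply pos_INR|].
    cbn [sumR].
    destruct (Nat.leb_spec lo n), (Nat.ltb_spec n hi); cbn [andb].
    - replace (Nat.min (S n) hi - lo)%nat with (S (Nat.min n hi - lo)) by lia.
      rewrite S_INR; lra.
    - replace (Nat.min (S n) hi - lo)%nat with (Nat.min n hi - lo)%nat by lia; lra.
    - eapply Rle_trans; [apply Rplus_le_compat_r, IH|].
      rewrite Rplus_0_r; apply le_INR; lia.
    - eapply Rle_trans; [apply Rplus_le_compat_r, IH|].
      rewrite Rplus_0_r; apply le_INR; lia. }
  eapply Rle_trans; [exact H | apply le_INR; lia].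
Qed.

Lemma minR_attained (n : nat) (f : nat -> R) : (1 <= n)%nat ->
  exists i, (i < n)%nat /\ minR n f = f i.
Proof.
  induction n as [|[|n] IH]; intros Hn; [lia | exists 0%nat; split; [lia|reflexivity]|].
  destruct IH as [i [Hi Hf]]; [lia|].
  change (minR (S (S n)) f) with (Rmin (minR (S n) f) (f (S n))); rewrite Hf.
  destruct (Rle_dec (f i) (f (S n))).
  - exists i; rewrite Rmin_left by assumption; split; [lia|reflexivity].
  - exists (S n); rewrite Rmin_right by lra; split; [lia|reflexivity].
Qed.

Lemma exp_monotone (x y : R) : x <= y -> exp x <= exp y.
Proof. intros [H | ->]; [left; now apply exp_increasing | right; reflexivity]. Qed.

(** The difference of the two sides vanishes at 0 and has derivative [exp (- x) - (1 - x) >= 0]. *)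
Lemma exp_neg_le_quadratic (x : R) : 0 <= x -> exp (- x) <= 1 - x + x ^ 2 / 2.
Proof.
  intros Hx.
  destruct Hx as [Hx | <-]; [|rewrite Ropp_0, exp_0; lra].
  set (g := fun x => 1 - x + x ^ 2 / 2 - exp (- x)).
  set (g' := fun x => exp (- x) - (1 - x)).
  destruct (MVT_cor2 g g' 0 x Hx) as [c [Hc Hc0]].
  - intros c _; unfold g, g'.
    replace (exp (- c) - (1 - c)) with
      ((0 - 1 + (INR 2 * c ^ 1 / 2)) - exp (- c) * (-1)) by (simpl; field).
    apply derivable_pt_lim_minus.
    + apply derivable_pt_lim_plus.
      * apply derivable_pt_lim_minus; [apply derivable_pt_lim_const | apply derivable_pt_lim_id].
      * unfold Rdiv.
        replace (INR 2 * c ^ 1 * / 2) with (INR 2 * c ^ 1 * / 2 + c ^ 2 * 0) by ring.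
        apply (derivable_pt_lim_mult (fun y => y ^ 2) (fun _ => / 2)).
        -- apply (derivable_pt_lim_pow c 2).
        -- apply derivable_pt_lim_const.
    + apply (derivable_pt_lim_comp Ropp exp).
      * apply (derivable_pt_lim_opp id c 1), derivable_pt_lim_id.
      * apply derivable_pt_lim_exp.
  - assert (Hg0 : g 0 = 0) by (unfold g; rewrite Ropp_0, exp_0; field).
    assert (0 <= g' c) by (unfold g'; pose proof (exp_ineq1_le (- c)); lra).
    assert (0 <= g x) by (rewrite Hg0 in Hc; nra).
    unfold g in *; lra.
Qed.

(** The quadratic bound at [2 * x], with [2 * x ^ 2 <= x] up to [1 / 2]. It turns the factors
    [1 - x] of a product into exponentials. *)
Lemma exp_neg_double_le (x : R) : 0 <= x <= 1 / 2 -> exp (- (2 * x)) <= 1 - x.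
Proof.
  intros Hx; pose proof (exp_neg_le_quadratic (2 * x)); nra.
Qed.

Lemma ln_le_sub_1 (x : R) : 0 < x -> ln x <= x - 1.
Proof.
  intros Hx; pose proof (exp_ineq1_le (ln x)) as H.
  rewrite exp_ln in H by exact Hx; lra.
Qed.

Lemma exp1_bounds : 2 <= exp 1 <= 3.
Proof. pose proof (exp_ineq1_le 1); pose proof exp_le_3; lra. Qed.

Lemma INR_le_pow2 (k : nat) : INR k <= 2 ^ k.
Proof.
  induction k as [|k IH]; [simpl; lra|].
  rewrite S_INR; simpl; pose proof (pow_R1_Rle 2 k ltac:(lra)); lra.
Qed.

(** Delays are integers while [beta] is real. Counting with the largest integer strictly below [b],
    or 0 if there is none, loses nothing to rounding up. *)
Lemma max_nat_below (b : R) :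
  exists c : nat, (forall d, INR d < b -> (d <= c)%nat) /\ ((0 < c)%nat -> INR c < b).
Proof.
  destruct (INR_unbounded b) as [N HN]; apply Rgt_lt in HN.
  induction N as [|N IH].
  - exists 0%nat; split; [|lia].
    intros d Hd; pose proof (pos_INR d); simpl in HN; lra.
  - destruct (Rlt_dec (INR N) b) as [H|H].
    + exists N; split; [|tauto].
      intros d Hd; apply Nat.lt_succ_r, INR_lt; lra.
    + destruct (Req_dec b (INR N)) as [E|Hne]; [|apply IH; lra]; rewrite E.
      clear IH HN H; destruct N as [|N].
      * exists 0%nat; split; [|lia].
        intros d Hd; apply INR_lt in Hd; lia.
      * exists N; split; [|intros _; apply lt_INR; lia].
        intros d Hd; apply INR_lt in Hd; lia.
Qed.

Lemma sumR_indicator_le1 (N i : nat) :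
  sumR N (fun a => if (a =? i)%nat then 1 else 0) <= 1.
Proof.
  destruct (Nat.le_gt_cases N i).
  - rewrite sumR_0; [lra|].
    intros a Ha; destruct (Nat.eqb_spec a i); [lia|reflexivity].
  - rewrite (sumR_delta N i (fun _ => 1)) by assumption; lra.
Qed.

(** * Exponential weights with delayed updates *)

Section DelayedHedge.

Variables (n : nat) (act : nat -> bool) (key : nat -> nat).

Definition asum (f : nat -> R) : R := sumR n (fun s => if act s then f s else 0).

(** [k] is a virtual clock: item [s] is processed at tick [key s], and ticks without an item are
    allowed. *)
Definition psum (k : nat) (f : nat -> R) : R :=
  sumR n (fun s => if act s && (key s <? k)%nat then f s else 0).

Lemma psum_0 (f : nat -> R) : psum 0 f = 0.
Proof.
  apply sumR_0; intros i Hi.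
  destruct (act i); cbn [andb]; [|reflexivity].
  destruct (Nat.ltb_spec (key i) 0); [lia|reflexivity].
Qed.

Lemma psum_all : exists N, forall k, (N <= k)%nat -> forall f, psum k f = asum f.
Proof.
  assert (H : forall m : nat, exists N, forall i, (i < m)%nat -> (key i < N)%nat).
  { clear; induction m as [|m [N IH]]; [exists 0%nat; lia|].
    exists (N + S (key m))%nat; intros i Hi.
    destruct (Nat.eq_dec i m) as [->|]; [lia|].
    specialize (IH i); lia. }
  destruct (H n) as [N HN]; exists N; intros k Hk f.
  apply sumR_ext; intros i Hi.
  destruct (act i); cbn [andb]; [|reflexivity].
  specialize (HN i Hi); destruct (Nat.ltb_spec (key i) k); [reflexivity|lia].
Qed.

Lemma psum_mono (k k' : nat) (f : nat -> R) :
  (forall s, (s < n)%nat -> act s = true -> 0 <= f s) -> (k <= k')%nat ->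
  psum k f <= psum k' f.
Proof.
  intros Hf Hk; apply sumR_le; intros i Hi.
  destruct (act i) eqn:E; cbn [andb]; [|lra].
  specialize (Hf i Hi E).
  destruct (Nat.ltb_spec (key i) k), (Nat.ltb_spec (key i) k'); try lia; lra.
Qed.

Lemma psum_diff (k k' : nat) (f : nat -> R) :
  (k <= k')%nat ->
  psum k' f - psum k f =
  sumR n (fun s => if act s && ((k <=? key s) && (key s <? k'))%nat then f s else 0).
Proof.
  intros Hk; unfold psum; rewrite <- sumR_minus; apply sumR_ext; intros s Hs.
  destruct (act s); cbn [andb]; [|ring].
  destruct (Nat.leb_spec k (key s)), (Nat.ltb_spec (key s) k'), (Nat.ltb_spec (key s) k);
    cbn [andb]; try lia; ring.
Qed.

Hypothesis key_inj : forall s s', (s < n)%nat -> (s' < n)%nat ->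
  act s = true -> act s' = true -> key s = key s' -> s = s'.

(** Injective keys put at most one item on a tick. The item is fixed before [f], so the same one
    serves the estimates of all actions and the count of items. *)
Lemma psum_S (k : nat) :
  (forall f, psum (S k) f = psum k f) \/
  (exists s, (s < n)%nat /\ act s = true /\ key s = k /\
     forall f, psum (S k) f = psum k f + f s).
Proof.
  unfold psum.
  destruct (existsb (fun s => act s && (key s =? k)%nat) (seq 0 n)) eqn:E.
  - right; apply existsb_exists in E as [s [Hs E]].
    apply in_seq in Hs; apply andb_prop in E as [Ha Ek]; apply Nat.eqb_eq in Ek.
    exists s; repeat split; [lia | assumption | assumption |].
    intros f; rewrite <- (sumR_delta n s f), <- sumR_plus by lia.
    apply sumR_ext; intros i Hi.
    destruct (Nat.eqb_spec i s) as [->|Hne].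
    + rewrite Ha; cbn [andb].
      destruct (Nat.ltb_spec (key s) (S k)), (Nat.ltb_spec (key s) k); try lia; ring.
    + destruct (act i) eqn:Hai; cbn [andb]; [|ring].
      assert (key i <> k) by (intros Hk; apply Hne, key_inj; try assumption; lia).
      destruct (Nat.ltb_spec (key i) (S k)), (Nat.ltb_spec (key i) k); try lia; ring.
  - left; intros f; apply sumR_ext; intros i Hi.
    destruct (act i) eqn:Hai; cbn [andb]; [|reflexivity].
    assert (key i <> k).
    { intros Hk.
      assert (existsb (fun s => act s && (key s =? k)%nat) (seq 0 n) = true).
      { apply existsb_exists; exists i; split; [apply in_seq; lia|].
        rewrite Hai, Hk, Nat.eqb_refl; reflexivity. }
      congruence. }
    destruct (Nat.ltb_spec (key i) (S k)), (Nat.ltb_spec (key i) k); try lia; ring.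
Qed.

Variables (K : nat) (x : nat -> nat -> R) (eta : R).

Definition hweight (k a : nat) : R := exp (- eta * psum k (fun s => x s a)).
Definition hpot (k : nat) : R := sumR K (hweight k).
Definition hdist (k a : nat) : R := hweight k a / hpot k.

Lemma hweight_gt0 (k a : nat) : 0 < hweight k a.
Proof. apply exp_pos. Qed.

Hypothesis K_gt0 : (1 <= K)%nat.

Lemma hpot_gt0 (k : nat) : 0 < hpot k.
Proof.
  unfold hpot; destruct K as [|K']; [lia|].
  rewrite sumR_S_l.
  pose proof (hweight_gt0 k 0).
  assert (0 <= sumR K' (fun i => hweight k (S i)));
    [apply sumR_ge0; intros; left; apply hweight_gt0 | lra].
Qed.

Lemma hdist_gt0 (k a : nat) : 0 < hdist k a.
Proof. apply Rdiv_lt_0_compat; [apply hweight_gt0 | apply hpot_gt0]. Qed.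

Lemma hdist_sum1 (k : nat) : sumR K (hdist k) = 1.
Proof.
  unfold hdist, Rdiv.
  rewrite (sumR_ext K _ (fun a => / hpot k * hweight k a)) by (intros; ring).
  rewrite sumR_scal; apply Rinv_l, Rgt_not_eq, hpot_gt0.
Qed.

Lemma hweight_eq (k a : nat) : hweight k a = hpot k * hdist k a.
Proof. unfold hdist; field; apply Rgt_not_eq, hpot_gt0. Qed.

Lemma hpot_S (k s : nat) :
  (forall f, psum (S k) f = psum k f + f s) ->
  hpot (S k) = hpot k * sumR K (fun a => hdist k a * exp (- (eta * x s a))).
Proof.
  intros Hs; unfold hpot at 1; rewrite <- sumR_scal.
  apply sumR_ext; intros a Ha.
  rewrite <- Rmult_assoc, <- hweight_eq.
  unfold hweight; rewrite Hs, <- exp_plus; f_equal; ring.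
Qed.

Hypothesis x_ge0 : forall s a, (s < n)%nat -> (a < K)%nat -> act s = true -> 0 <= x s a.
Hypothesis eta_gt0 : 0 < eta.

(** Each item multiplies the total weight by the mean of [exp (- eta x)] under the current
    distribution. The quadratic bound and [ln g <= g - 1] charge this to the first two moments. *)
Lemma hedge_potential (k : nat) :
  psum k (fun s => eta * sumR K (fun a => hdist (key s) a * x s a)
                   - eta ^ 2 / 2 * sumR K (fun a => hdist (key s) a * x s a ^ 2))
  <= ln (INR K) - ln (hpot k).
Proof.
  induction k as [|k IH].
  - rewrite psum_0.
    replace (hpot 0) with (INR K); [lra|].
    unfold hpot, hweight.
    rewrite (sumR_ext K _ (fun _ => 1)), sumR_const; [ring|].
    intros a _; rewrite psum_0, Rmult_0_r; apply exp_0.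
  - destruct (psum_S k) as [H | [s [Hs [Ha [Hk H]]]]].
    + rewrite H; unfold hpot, hweight in *.
      rewrite (sumR_ext K _ (fun a => exp (- eta * psum k (fun s => x s a))));
        [exact IH | intros; now rewrite H].
    + rewrite H, Hk, (hpot_S k s H).
      set (y := sumR K (fun a => hdist k a * x s a)).
      set (z := sumR K (fun a => hdist k a * x s a ^ 2)).
      set (g := sumR K (fun a => hdist k a * exp (- (eta * x s a)))).
      assert (Hg : 0 < g).
      { pose proof (hpot_gt0 (S k)) as P; rewrite (hpot_S k s H) in P; fold g in P.
        pose proof (hpot_gt0 k); nra. }
      rewrite ln_mult by (try apply hpot_gt0; exact Hg).
      assert (g <= 1 - eta * y + eta ^ 2 / 2 * z).
      { replace (1 - eta * y + eta ^ 2 / 2 * z) with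
          (sumR K (fun a => hdist k a - eta * (hdist k a * x s a)
                            + eta ^ 2 / 2 * (hdist k a * x s a ^ 2))).
        - apply sumR_le; intros a HaK.
          pose proof (hdist_gt0 k a).
          pose proof (exp_neg_le_quadratic (eta * x s a)
            (Rmult_le_pos _ _ (Rlt_le _ _ eta_gt0) (x_ge0 s a Hs HaK Ha))).
          replace (hdist k a - eta * (hdist k a * x s a)
                   + eta ^ 2 / 2 * (hdist k a * x s a ^ 2)) with
            (hdist k a * (1 - eta * x s a + (eta * x s a) ^ 2 / 2)) by field.
          apply Rmult_le_compat_l; lra.
        - rewrite sumR_plus, sumR_minus, !sumR_scal, hdist_sum1; reflexivity. }
      pose proof (ln_le_sub_1 g Hg); lra.
Qed.

(** The final total weight is at least the weight of [a] alone; the rest is the potential bound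
    divided by [eta]. *)
Lemma hedge_regret (a : nat) : (a < K)%nat ->
  asum (fun s => sumR K (fun b => hdist (key s) b * x s b)) <=
  ln (INR K) / eta + asum (fun s => x s a)
  + eta / 2 * asum (fun s => sumR K (fun b => hdist (key s) b * x s b ^ 2)).
Proof.
  intros Ha; destruct psum_all as [N HN].
  pose proof (hedge_potential N) as H; rewrite HN in H by lia.
  assert (Hln : - eta * asum (fun s => x s a) <= ln (hpot N)).
  { rewrite <- (HN N) by lia.
    rewrite <- (ln_exp (- eta * _)).
    destruct (Rle_lt_or_eq_dec (hweight N a) (hpot N)) as [Hlt | Heq].
    - apply sumR_term_le; [exact Ha | intros; left; apply hweight_gt0].
    - left; apply ln_increasing; [apply exp_pos | exact Hlt].
    - right; now rewrite <- Heq. }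
  set (Y := asum (fun s => sumR K (fun b => hdist (key s) b * x s b))).
  set (Z := asum (fun s => sumR K (fun b => hdist (key s) b * x s b ^ 2))).
  assert (HE : asum (fun s => eta * sumR K (fun b => hdist (key s) b * x s b)
            - eta ^ 2 / 2 * sumR K (fun b => hdist (key s) b * x s b ^ 2))
          = eta * Y - eta ^ 2 / 2 * Z).
  { unfold Y, Z, asum; rewrite <- !sumR_scal, <- sumR_minus.
    apply sumR_ext; intros i _; destruct (act i); ring. }
  rewrite HE in H.
  apply (Rmult_le_reg_l eta); [exact eta_gt0|].
  replace (eta * (ln (INR K) / eta + asum (fun s => x s a) + eta / 2 * Z)) with
    (ln (INR K) + eta * asum (fun s => x s a) + eta ^ 2 / 2 * Z) by (field; lra).
  lra.
Qed.

Lemma hpot_antitone (k k' : nat) : (k <= k')%nat -> hpot k' <= hpot k.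
Proof.
  intros Hk; apply sumR_le; intros a Ha; apply exp_monotone.
  pose proof (psum_mono k k' (fun s => x s a) (fun s Hs E => x_ge0 s a Hs Ha E) Hk); nra.
Qed.

(** One item multiplies the total weight by at least [1 - eta * c >= exp (- 2 * eta * c)]; the
    number of items is the [psum] of the constant 1. *)
Lemma hpot_decay (c : R) (k k' : nat) :
  (k <= k')%nat ->
  (forall s, (s < n)%nat -> act s = true -> (k <= key s < k')%nat ->
     0 <= eta * c <= 1 / 2 /\ sumR K (fun a => hdist (key s) a * x s a) <= c) ->
  hpot k * exp (- (2 * (eta * c)) * (psum k' (fun _ => 1) - psum k (fun _ => 1))) <= hpot k'.
Proof.
  intros Hk; induction Hk as [|k' Hk IH]; intros H.
  - rewrite Rminus_diag_eq, Rmult_0_r, exp_0 by reflexivity; lra.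
  - destruct (psum_S k') as [E | [s [Hs [Ha [Hks E]]]]].
    + rewrite E; unfold hpot at 2, hweight.
      rewrite (sumR_ext K _ (hweight k')) by (intros; unfold hweight; now rewrite E).
      apply IH; intros; apply H; [assumption..|lia].
    + destruct (H s Hs Ha) as [Hc Hy]; [lia|]; rewrite Hks in Hy.
      rewrite (hpot_S k' s E), E.
      replace (- (2 * (eta * c)) * (psum k' (fun _ => 1) + 1 - psum k (fun _ => 1)))
        with (- (2 * (eta * c)) * (psum k' (fun _ => 1) - psum k (fun _ => 1))
              + - (2 * (eta * c))) by ring.
      rewrite exp_plus, <- Rmult_assoc.
      apply Rmult_le_compat.
      * apply Rmult_le_pos; left; [apply hpot_gt0 | apply exp_pos].
      * left; apply exp_pos.
      * apply IH; intros; apply H; [assumption..|lia].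
      * apply Rle_trans with (1 := exp_neg_double_le _ Hc).
        apply Rle_trans with (sumR K (fun a => hdist k' a - eta * (hdist k' a * x s a))).
        -- rewrite sumR_minus, sumR_scal, hdist_sum1; nra.
        -- apply sumR_le; intros a HaK.
           pose proof (hdist_gt0 k' a); pose proof (exp_ineq1_le (- (eta * x s a))).
           nra.
Qed.

(** The total weight only decreases, so keeping the earlier one lowers the ratio; then
    [exp (- y) >= 1 - y]. *)
Lemma hdist_ge (k k' a : nat) : (a < K)%nat -> (k <= k')%nat ->
  hdist k a * (1 - eta * (psum k' (fun s => x s a) - psum k (fun s => x s a))) <= hdist k' a.
Proof.
  intros Ha Hk; set (d := psum k' _ - psum k _).
  assert (Hw : hweight k' a = hweight k a * exp (- (eta * d))).
  { unfold hweight, d; rewrite <- exp_plus; f_equal; ring. }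
  unfold hdist; rewrite Hw; unfold Rdiv.
  pose proof (hpot_antitone k k' Hk); pose proof (hpot_gt0 k); pose proof (hpot_gt0 k').
  pose proof (hweight_gt0 k a).
  assert (Hinv : / hpot k <= / hpot k') by (apply Rinv_le_contravar; assumption).
  pose proof (exp_ineq1_le (- (eta * d))).
  assert (0 < / hpot k) by (apply Rinv_0_lt_compat; assumption).
  pose proof (exp_pos (- (eta * d))).
  apply Rle_trans with (hweight k a * / hpot k * exp (- (eta * d))).
  - apply Rmult_le_compat_l; [apply Rmult_le_pos; lra | lra].
  - replace (hweight k a * / hpot k * exp (- (eta * d))) with
      (hweight k a * exp (- (eta * d)) * / hpot k) by ring.
    apply Rmult_le_compat_l; [apply Rmult_le_pos; lra | exact Hinv].
Qed.

(** Weights only decrease, so a probability can grow only through the drop of the total weight. The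
    product form leaves that drop to [hpot_decay]. *)
Lemma hdist_le (k k' a : nat) : (a < K)%nat -> (k <= k')%nat ->
  hdist k' a * hpot k' <= hdist k a * hpot k.
Proof.
  intros Ha Hk; rewrite !(Rmult_comm (hdist _ _)), <- !hweight_eq.
  apply exp_monotone.
  pose proof (psum_mono k k' (fun s => x s a) (fun s Hs E => x_ge0 s a Hs Ha E) Hk); nra.
Qed.

End DelayedHedge.

Lemma asum_plus (n : nat) (act : nat -> bool) (f g : nat -> R) :
  asum n act (fun s => f s + g s) = asum n act f + asum n act g.
Proof.
  unfold asum; rewrite <- sumR_plus; apply sumR_ext; intros s _; destruct (act s); ring.
Qed.

Lemma asum_scal (n : nat) (act : nat -> bool) (c : R) (f : nat -> R) :
  asum n act (fun s => c * f s) = c * asum n act f.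
Proof.
  unfold asum; rewrite <- sumR_scal; apply sumR_ext; intros s _; destruct (act s); ring.
Qed.

Lemma asum_le (n : nat) (act : nat -> bool) (f g : nat -> R) :
  (forall s, (s < n)%nat -> act s = true -> f s <= g s) ->
  asum n act f <= asum n act g.
Proof.
  intros H; apply sumR_le; intros s Hs; destruct (act s) eqn:E; [now apply H | lra].
Qed.

Lemma asum_S (n : nat) (act : nat -> bool) (f : nat -> R) :
  asum (S n) act f = asum n act f + (if act n then f n else 0).
Proof. reflexivity. Qed.

(** * The randomized play and its expectation *)

Section Process.

Variables (K : nat) (dl : nat -> nat) (loss : nat -> nat -> R).
Definition prob (A : nat -> nat) (t a : nat) : R := pvec K dl loss A t t a.

Definition est_loss (A : nat -> nat) (s a : nat) : R :=
  if (A s =? a)%nat then loss s a / prob A s a else 0.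

Definition fed (m s : nat) : bool :=
  (1 <=? s)%nat && (epoch K dl s =? m)%nat && isSmall K m (dl s).

(* Orders the rounds s <= T by arrival time s + dl s, breaking ties by s. *)
Definition arrival_key (T s : nat) : nat := ((s + dl s) * S T + s)%nat.

Definition upd (A : nat -> nat) (s b : nat) : nat -> nat :=
  fun u => if (u =? s)%nat then b else A u.

Lemma pvec_diag (A : nat -> nat) (t s a : nat) :
  (s <= t)%nat -> pvec K dl loss A t s a = prob A s a.
Proof.
  unfold prob; induction t as [|t IH]; intros Hs.
  - now replace s with 0%nat by lia.
  - destruct (Nat.eq_dec s (S t)) as [->|Hne]; [reflexivity|].
    cbn [pvec]; destruct (Nat.eqb_spec s (S t)); [lia|]; apply IH; lia.
Qed.

Lemma prob_S (A : nat -> nat) (t a : nat) (c : nat -> R) :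
  (forall b, c b = sumR (S t) (fun s =>
     if fed (epoch K dl (S t)) s && (s + dl s <? S t)%nat then est_loss A s b else 0)) ->
  prob A (S t) a =
  exp (- eta'_m K (epoch K dl (S t)) * c a)
  / sumR K (fun b => exp (- eta'_m K (epoch K dl (S t)) * c b)).
Proof.
  intros Hc.
  assert (H : forall b, weight K dl loss A (pvec K dl loss A t) (S t) b
                        = exp (- eta'_m K (epoch K dl (S t)) * c b)).
  { intros b; unfold weight; do 2 f_equal; rewrite Hc; unfold cumloss.
    apply sumR_ext; intros s Hs; unfold fed, est_loss.
    replace (s + dl s <=? S t - 1)%nat with (s + dl s <? S t)%nat
      by (destruct (Nat.ltb_spec (s + dl s) (S t)), (Nat.leb_spec (s + dl s) (S t - 1)); lia).
    rewrite pvec_diag by lia; reflexivity. }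
  unfold prob; cbn [pvec]; rewrite Nat.eqb_refl; unfold pdist.
  rewrite H; f_equal; apply sumR_ext; intros; apply H.
Qed.

(** The tie-breaker is at most [T], so the items arriving in one round occupy one block of [S T]
    ticks. Tick [t * S T] is therefore the moment at which [p_t] is computed. *)
Lemma arrival_key_lt (T s t : nat) :
  (s <= T)%nat -> (arrival_key T s <? t * S T)%nat = (s + dl s <? t)%nat.
Proof.
  intros Hs; unfold arrival_key.
  destruct (Nat.ltb_spec ((s + dl s) * S T + s) (t * S T)),
           (Nat.ltb_spec (s + dl s) t); try reflexivity; nia.
Qed.

Lemma prob_hdist (A : nat -> nat) (T t a : nat) : (1 <= t <= T)%nat ->
  prob A t a = hdist (S T) (fed (epoch K dl t)) (arrival_key T) K (est_loss A)
                 (eta'_m K (epoch K dl t)) (t * S T) a.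
Proof.
  intros Ht; destruct t as [|t]; [lia|].
  unfold hdist, hpot, hweight.
  apply (prob_S A t a (fun b => psum (S T) (fed (epoch K dl (S t))) (arrival_key T)
    (S t * S T) (fun s => est_loss A s b))).
  intros b; unfold psum.
  (* Rounds from [S t] on arrive no earlier than [S t], so extending the sum up to [T] adds
     zeros. *)
  assert (H : forall d, sumR (S t + d) (fun s =>
      if fed (epoch K dl (S t)) s && (s + dl s <? S t)%nat then est_loss A s b else 0)
    = sumR (S t) (fun s =>
      if fed (epoch K dl (S t)) s && (s + dl s <? S t)%nat then est_loss A s b else 0)).
  { induction d as [|d IH]; [now rewrite Nat.add_0_r|].
    rewrite Nat.add_succ_r; cbn [sumR]; cbn [sumR] in IH; rewrite IH.
    destruct (Nat.ltb_spec (S t + d + dl (S t + d)) (S t)); [lia|].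
    rewrite andb_false_r; ring. }
  rewrite <- (H (S T - S t)%nat); replace (S t + (S T - S t))%nat with (S T) by lia.
  apply sumR_ext; intros s Hs; rewrite arrival_key_lt by lia; reflexivity.
Qed.

Lemma est_loss_ext (A B : nat -> nat) (s a : nat) :
  A s = B s -> prob A s a = prob B s a -> est_loss A s a = est_loss B s a.
Proof. unfold est_loss; intros -> ->; reflexivity. Qed.

Lemma prob_agree (A B : nat -> nat) (t a : nat) :
  (forall u, (u < t)%nat -> (u + dl u < t)%nat -> A u = B u) ->
  (forall u b, (u < t)%nat -> (u + dl u < t)%nat -> prob A u b = prob B u b) ->
  prob A t a = prob B t a.
Proof.
  destruct t as [|t]; [reflexivity|]; intros HA HP.
  set (c := fun b => sumR (S t) (fun s =>
    if fed (epoch K dl (S t)) s && (s + dl s <? S t)%nat then est_loss A s b else 0)).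
  rewrite (prob_S A t a c), (prob_S B t a c); [reflexivity | | reflexivity].
  intros b; apply sumR_ext; intros s Hs.
  destruct (Nat.ltb_spec (s + dl s) (S t)) as [Hlt|]; [|now rewrite andb_false_r].
  rewrite (est_loss_ext A B) by auto; reflexivity.
Qed.

Lemma prob_past (A B : nat -> nat) (t a : nat) :
  (forall u, (u < t)%nat -> A u = B u) -> prob A t a = prob B t a.
Proof.
  revert a; induction t as [t IH] using (well_founded_induction Nat.lt_wf_0).
  intros a H; apply prob_agree; [auto|].
  intros u b Hu _; apply IH; [assumption|]; intros; apply H; lia.
Qed.

(** The action of [s] could enter [p_t] only through the feedback of [s], not yet arrived, or
    through importance weights of earlier rounds, which the strong induction covers. *)
Lemma prob_upd (A : nat -> nat) (s b t a : nat) : (t <= s + dl s)%nat ->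
  prob (upd A s b) t a = prob A t a.
Proof.
  revert a; induction t as [t IH] using (well_founded_induction Nat.lt_wf_0).
  intros a Ht; apply prob_agree.
  - intros u Hu Hd; unfold upd; destruct (Nat.eqb_spec u s) as [->|]; [lia|reflexivity].
  - intros u c Hu _; apply IH; lia.
Qed.

Lemma est_loss_upd (A : nat -> nat) (s b u a : nat) : (u <= s + dl s)%nat -> u <> s ->
  est_loss (upd A s b) u a = est_loss A u a.
Proof.
  intros Hu Hne; apply est_loss_ext; [|now apply prob_upd].
  unfold upd; destruct (Nat.eqb_spec u s); [contradiction|reflexivity].
Qed.

(** Conditional expectation given the actions of [A] before [t], with [k] rounds still to be drawn,
    following the recursion of [ev]. Actions after the last drawn round keep their values in [A]. *)
Fixpoint expect (k t : nat) (A : nat -> nat) (f : (nat -> nat) -> R) : R :=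
  match k with
  | O => f A
  | S k' => sumR K (fun a => prob A t a * expect k' (S t) (upd A t a) f)
  end.

Lemma upd_lt (A B : nat -> nat) (t a : nat) :
  (forall u, (u < S t)%nat -> B u = upd A t a u) ->
  B t = a /\ forall u, (u < t)%nat -> B u = A u.
Proof.
  intros H; split.
  - rewrite H by lia; unfold upd; now rewrite Nat.eqb_refl.
  - intros u Hu; rewrite H by lia; unfold upd.
    destruct (Nat.eqb_spec u t); [lia|reflexivity].
Qed.

Lemma expect_ext (k t : nat) (A : nat -> nat) (f g : (nat -> nat) -> R) :
  (forall B, (forall u, (u < t)%nat -> B u = A u) -> f B = g B) ->
  expect k t A f = expect k t A g.
Proof.
  revert t A; induction k as [|k IH]; intros t A H; simpl; [now apply H|].
  apply sumR_ext; intros a Ha; f_equal; apply IH.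
  intros B HB; apply H; now apply upd_lt in HB.
Qed.

Lemma expect_plus (k t : nat) (A : nat -> nat) (f g : (nat -> nat) -> R) :
  expect k t A (fun B => f B + g B) = expect k t A f + expect k t A g.
Proof.
  revert t A; induction k as [|k IH]; intros t A; simpl; [reflexivity|].
  rewrite <- sumR_plus; apply sumR_ext; intros; rewrite IH; ring.
Qed.

Lemma expect_scal (k t : nat) (A : nat -> nat) (c : R) (f : (nat -> nat) -> R) :
  expect k t A (fun B => c * f B) = c * expect k t A f.
Proof.
  revert t A; induction k as [|k IH]; intros t A; simpl; [reflexivity|].
  rewrite <- sumR_scal; apply sumR_ext; intros; rewrite IH; ring.
Qed.

Lemma upd_comm (A : nat -> nat) (s t b c : nat) : s <> t ->
  upd (upd A s b) t c = upd (upd A t c) s b.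
Proof.
  intros Hne; apply functional_extensionality; intros u; unfold upd.
  destruct (Nat.eqb_spec u t), (Nat.eqb_spec u s); try reflexivity; lia.
Qed.

Hypothesis K_gt0 : (1 <= K)%nat.

Lemma prob_gt0 (A : nat -> nat) (t a : nat) : (1 <= t)%nat -> 0 < prob A t a.
Proof. intros Ht; rewrite (prob_hdist A t) by lia; apply hdist_gt0; exact K_gt0. Qed.

Lemma prob_sum1 (A : nat -> nat) (t : nat) : (1 <= t)%nat -> sumR K (prob A t) = 1.
Proof.
  intros Ht; rewrite <- (hdist_sum1 (S t) (fed (epoch K dl t)) (arrival_key t) K
    (est_loss A) (eta'_m K (epoch K dl t)) K_gt0 (t * S t)).
  apply sumR_ext; intros; apply prob_hdist; lia.
Qed.

Lemma expect_le (k t : nat) (A : nat -> nat) (f g : (nat -> nat) -> R) :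
  (1 <= t)%nat -> (forall B, f B <= g B) -> expect k t A f <= expect k t A g.
Proof.
  revert t A; induction k as [|k IH]; intros t A Ht H; simpl; [apply H|].
  apply sumR_le; intros a Ha; apply Rmult_le_compat_l.
  - left; now apply prob_gt0.
  - apply IH; [lia | assumption].
Qed.

Lemma expect_const (k t : nat) (A : nat -> nat) (c : R) :
  (1 <= t)%nat -> expect k t A (fun _ => c) = c.
Proof.
  revert t A; induction k as [|k IH]; intros t A Ht; simpl; [reflexivity|].
  rewrite (sumR_ext K _ (fun a => c * prob A t a)) by (intros; rewrite IH by lia; ring).
  rewrite sumR_scal, prob_sum1 by assumption; ring.
Qed.

Lemma expect_sumR (k t : nat) (A : nat -> nat) (n : nat) (f : nat -> (nat -> nat) -> R) :
  (1 <= t)%nat ->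
  expect k t A (fun B => sumR n (fun i => f i B)) = sumR n (fun i => expect k t A (f i)).
Proof.
  intros Ht; induction n as [|n IH]; simpl; [now apply expect_const|].
  now rewrite expect_plus, IH.
Qed.

Lemma expect_measurable (k t : nat) (A : nat -> nat) (f : (nat -> nat) -> R) :
  (1 <= t)%nat -> (forall B u b, (t <= u)%nat -> f (upd B u b) = f B) ->
  expect k t A f = f A.
Proof.
  revert t A; induction k as [|k IH]; intros t A Ht H; simpl; [reflexivity|].
  rewrite (sumR_ext K _ (fun a => f A * prob A t a)).
  - rewrite sumR_scal, prob_sum1 by assumption; ring.
  - intros a Ha; rewrite IH, H; [ring | lia | lia |].
    intros; apply H; lia.
Qed.

(** Up to round [s + dl s] the distributions do not see the change; after it [f] no longer reads the
    rounds drawn, so these integrate out. *)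
Lemma expect_upd (k t s b : nat) (A : nat -> nat) (f : (nat -> nat) -> R) :
  (1 <= t)%nat -> (s < t)%nat -> (forall B c, f (upd B s c) = f B) ->
  (forall B u c, (s + dl s < u)%nat -> f (upd B u c) = f B) ->
  expect k t (upd A s b) f = expect k t A f.
Proof.
  revert t A; induction k as [|k IH]; intros t A Ht Hs H1 H2; simpl; [apply H1|].
  destruct (Nat.le_gt_cases t (s + dl s)) as [Hle|Hgt].
  - apply sumR_ext; intros a Ha.
    rewrite prob_upd, upd_comm, IH by (assumption || lia); reflexivity.
  - assert (HB : forall B, expect (S k) t B f = f B).
    { intros B; apply expect_measurable; [assumption|].
      intros; apply H2; lia. }
    simpl in HB; rewrite !HB; apply H1.
Qed.

(** Round [s] draws [a] with exactly the probability that the estimate divides by. The factor [f]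
    may be random, but it ignores the action of [s] and all that follows the arrival of its
    feedback, so [expect_upd] frees the remaining expectation from the drawn action. *)
Lemma expect_est_loss (k t s a : nat) (A : nat -> nat) (f : (nat -> nat) -> R) :
  (1 <= t)%nat -> (t <= s < t + k)%nat -> (a < K)%nat ->
  (forall B c, f (upd B s c) = f B) ->
  (forall B u c, (s + dl s < u)%nat -> f (upd B u c) = f B) ->
  expect k t A (fun B => est_loss B s a * f B) = loss s a * expect k t A f.
Proof.
  revert t A; induction k as [|k IH]; intros t A Ht Hs Ha H1 H2; [lia|]; simpl.
  rewrite <- sumR_scal.
  destruct (Nat.eq_dec t s) as [->|Hne].
  - rewrite (sumR_ext K _ (fun b => if (b =? a)%nat then
       loss s b * expect k (S s) A f else 0)).
    + rewrite sumR_delta by exact Ha.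
      rewrite (sumR_ext K _ (fun b => loss s a * expect k (S s) A f * prob A s b)).
      * rewrite sumR_scal, prob_sum1 by exact Ht; ring.
      * intros b Hb; rewrite expect_upd by (assumption || lia); ring.
    + intros b Hb.
      rewrite (expect_ext k (S s) (upd A s b) _
        (fun B => (if (b =? a)%nat then loss s a / prob A s a else 0) * f B)).
      * rewrite expect_scal, expect_upd by (assumption || lia).
        destruct (Nat.eqb_spec b a) as [->|]; [|ring].
        field; apply Rgt_not_eq; now apply prob_gt0.
      * intros B HB; apply upd_lt in HB as [HBs HBu].
        unfold est_loss; rewrite HBs, (prob_past B A) by assumption; reflexivity.
  - apply sumR_ext; intros b Hb; rewrite IH by (assumption || lia); ring.
Qed.

(** The loss of the drawn action is replaced by its mean given the past, so that the regret becomes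
    linear in the distributions. *)
Lemma ev_expect (k t : nat) (A : nat -> nat) : (1 <= t)%nat ->
  ev K dl loss k t A =
  expect k t A (fun B => sumR k (fun i =>
    sumR K (fun a => prob B (t + i) a * loss (t + i)%nat a))).
Proof.
  revert t A; induction k as [|k IH]; intros t A Ht; [reflexivity|].
  cbn [ev expect].
  set (c := sumR K (fun a => prob A t a * loss t a)).
  set (g := fun B => sumR k (fun i =>
    sumR K (fun a => prob B (S t + i) a * loss (S t + i)%nat a))).
  transitivity (c + sumR K (fun a => prob A t a * expect k (S t) (upd A t a) g)).
  - unfold c; rewrite <- sumR_plus; apply sumR_ext; intros a Ha.
    fold (upd A t a); fold (prob (upd A t a) t a).
    rewrite prob_upd, IH by lia; fold g; ring.
  - transitivity (sumR K (fun a => c * prob A t a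
                    + prob A t a * expect k (S t) (upd A t a) g)).
    + rewrite sumR_plus, sumR_scal, prob_sum1 by exact Ht; ring.
    + apply sumR_ext; intros a Ha.
      rewrite (expect_ext k (S t) (upd A t a) (fun B => sumR (S k) _) (fun B => c + g B)).
      * rewrite expect_plus, expect_const by lia; ring.
      * intros B HB; apply upd_lt in HB as [_ HB].
        rewrite sumR_S_l, Nat.add_0_r; f_equal.
        -- apply sumR_ext; intros b Hb; rewrite (prob_past B A) by exact HB; reflexivity.
        -- apply sumR_ext; intros i Hi; rewrite Nat.add_succ_r; reflexivity.
Qed.

End Process.

(** * Regret within one epoch *)

Lemma omega_ge1 (m : nat) : 1 <= omega m.
Proof. unfold omega; apply pow_R1_Rle; lra. Qed.

Lemma sqrt_omega_sqr (m : nat) : sqrt (omega m) * sqrt (omega m) = omega m.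
Proof. apply sqrt_sqrt; pose proof (omega_ge1 m); lra. Qed.

Lemma sqrt_omega_ge1 (m : nat) : 1 <= sqrt (omega m).
Proof. rewrite <- sqrt_1; apply sqrt_le_1_alt, omega_ge1. Qed.

Lemma sqrt_omega_le (m : nat) : sqrt (omega m) <= omega m.
Proof. rewrite <- sqrt_omega_sqr at 2; pose proof (sqrt_omega_ge1 m); nra. Qed.

Lemma omega_S (m : nat) : omega (S m) = 2 * omega m.
Proof. reflexivity. Qed.

(** The geometric sum of ratio [sqrt 2] over the indices below [m] is at most
    [sqrt (omega m) / (sqrt 2 - 1)], and [1 / (sqrt 2 - 1) = sqrt 2 + 1]. Going two indices further
    costs a factor 2, and [2 * (sqrt 2 + 1) <= 5]. *)
Lemma sum_sqrt_omega_le (j : nat) :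
  sumR (S (S j)) (fun m => sqrt (omega m)) <= 5 * sqrt (omega j).
Proof.
  assert (Hr : sqrt 2 * sqrt 2 = 2) by (apply sqrt_sqrt; lra).
  pose proof (sqrt_lt_R0 2 ltac:(lra)) as Hr0.
  assert (HS : forall m, sqrt (omega (S m)) = sqrt 2 * sqrt (omega m)).
  { intros m; rewrite omega_S; apply sqrt_mult; pose proof (omega_ge1 m); lra. }
  assert (H : forall m, sumR m (fun i => sqrt (omega i)) <= (sqrt 2 + 1) * sqrt (omega m)).
  { induction m as [|m IH]; [pose proof (sqrt_omega_ge1 0); simpl in *; nra|].
    cbn [sumR]; rewrite HS.
    replace ((sqrt 2 + 1) * (sqrt 2 * sqrt (omega m))) with
      ((sqrt 2 * sqrt 2 + sqrt 2) * sqrt (omega m)) by ring.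
    rewrite Hr; lra. }
  eapply Rle_trans; [apply H|]; rewrite !HS.
  replace ((sqrt 2 + 1) * (sqrt 2 * (sqrt 2 * sqrt (omega j)))) with
    ((sqrt 2 * sqrt 2) * ((sqrt 2 + 1) * sqrt (omega j))) by ring.
  rewrite Hr; pose proof (sqrt_omega_ge1 j).
  assert (sqrt 2 <= 3 / 2) by nra.
  nra.
Qed.

Lemma ln_K_gt0 (K : nat) : (2 <= K)%nat -> 0 < ln (INR K).
Proof.
  intros HK.
  rewrite <- ln_1; apply ln_increasing; [lra|].
  apply (lt_INR 1); lia.
Qed.

Lemma omega_gt0 (m : nat) : 0 < omega m.
Proof. apply pow_lt; lra. Qed.

Lemma beta_m_gt0 (K m : nat) : (2 <= K)%nat -> 0 < beta_m K m.
Proof.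
  intros HK.
  unfold beta_m; apply Rdiv_lt_0_compat; [apply sqrt_lt_R0, omega_gt0|].
  pose proof (exp_pos 1); pose proof (ln_K_gt0 K HK); apply Rmult_lt_0_compat; lra.
Qed.

Lemma eta'_m_beta (K m : nat) : eta'_m K m = / (4 * exp 1 * beta_m K m).
Proof.
  unfold eta'_m, eta_m; apply Rmin_right; right; unfold Rdiv; ring.
Qed.

Lemma eta'_m_eq (K m : nat) : (2 <= K)%nat -> eta'_m K m = ln (INR K) / sqrt (omega m).
Proof.
  intros HK.
  rewrite eta'_m_beta; unfold beta_m.
  pose proof (exp_pos 1); pose proof (ln_K_gt0 K HK); pose proof (sqrt_lt_R0 _ (omega_gt0 m)).
  field; repeat split; lra.
Qed.

Lemma eta'_m_gt0 (K m : nat) : (2 <= K)%nat -> 0 < eta'_m K m.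
Proof.
  intros HK.
  rewrite eta'_m_eq by exact HK; apply Rdiv_lt_0_compat;
    [now apply ln_K_gt0 | apply sqrt_lt_R0, omega_gt0].
Qed.

Section Epoch.

Variables (K T : nat) (dl : nat -> nat) (loss : nat -> nat -> R) (m : nat).
Hypothesis K_ge2 : (2 <= K)%nat.
Hypothesis loss_01 :
  forall t a, (1 <= t <= T)%nat -> (a < K)%nat -> 0 <= loss t a <= 1.

Let n := S T.
Let key := arrival_key dl T.
Let act := fed K dl m.
Let eta := eta'_m K m.
Let beta := beta_m K m.
Notation p := (prob K dl loss).
Notation x := (est_loss K dl loss).
Notation q A s a := (hdist n act key K (x A) eta (key s) a).

(* s' is pending for s: its feedback is processed between the computation of the
   distribution of round s and the processing of the feedback of round s. *)
Definition pending (s' s : nat) : bool :=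
  fed K dl m s' && ((s * n <=? key s') && (key s' <? key s))%nat.

Lemma fed_spec (s : nat) :
  fed K dl m s = true -> (1 <= s)%nat /\ epoch K dl s = m /\ INR (dl s) < beta_m K m.
Proof.
  unfold fed, isSmall, ltb_R; intros H.
  apply andb_prop in H as [H Hd]; apply andb_prop in H as [H1 He].
  apply Nat.leb_le in H1; apply Nat.eqb_eq in He.
  destruct (Rlt_dec (INR (dl s)) (beta_m K m)); [auto | discriminate].
Qed.

Lemma est_loss_ge0 (A : nat -> nat) (s a : nat) :
  (s < n)%nat -> (a < K)%nat -> act s = true -> 0 <= x A s a.
Proof.
  intros Hs Ha Hact; apply fed_spec in Hact as [H1 _]; unfold est_loss.
  destruct (A s =? a)%nat; [|lra].
  unfold n in Hs; destruct (loss_01 s a) as [H0 _]; [lia | exact Ha|].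
  apply Rmult_le_pos; [exact H0 | left; apply Rinv_0_lt_compat, prob_gt0; lia].
Qed.

Lemma prob_est_loss_le (A : nat -> nat) (s a : nat) :
  (s < n)%nat -> (a < K)%nat -> act s = true ->
  p A s a * x A s a <= if (a =? A s)%nat then 1 else 0.
Proof.
  intros Hs Ha Hact; apply fed_spec in Hact as [H1 _]; unfold est_loss.
  rewrite Nat.eqb_sym; destruct (a =? A s)%nat; [|lra].
  assert (0 < p A s a) by (apply prob_gt0; lia).
  unfold n in Hs; destruct (loss_01 s a) as [_ H0]; [lia | exact Ha|].
  replace (p A s a * (loss s a / p A s a)) with (loss s a); [exact H0|].
  field; lra.
Qed.

Lemma arrival_key_inj (s s' : nat) : (s < n)%nat -> (s' < n)%nat ->
  act s = true -> act s' = true -> key s = key s' -> s = s'.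
Proof.
  unfold n, key, arrival_key; intros Hs Hs' _ _ H.
  assert (s + dl s = s' + dl s')%nat by nia; nia.
Qed.

Lemma key_ge (s : nat) : (s * n <= key s)%nat.
Proof. unfold key, n, arrival_key; nia. Qed.

(** Either an earlier round is still outstanding when [s] is played, or a later round is played
    while [s] is outstanding and overtakes it. Ties in arrival go to the smaller index, hence the
    strict inequality in the second case. In both cases neither feedback is available when the other
    round is played. *)
Lemma pending_cases (s' s : nat) : (s < n)%nat -> (s' < n)%nat -> pending s' s = true ->
  fed K dl m s' = true /\
  ((s' < s <= s' + dl s')%nat /\ (s' + dl s' <= s + dl s)%nat \/
   (s < s' <= s + dl s)%nat /\ (s' + dl s' < s + dl s)%nat).
Proof.
  unfold pending, key, n, arrival_key; intros Hs Hs' H.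
  apply andb_prop in H as [Hf H]; apply andb_prop in H as [H1 H2].
  apply Nat.leb_le in H1; apply Nat.ltb_lt in H2; split; [exact Hf|].
  assert (s <= s' + dl s')%nat by nia.
  assert (s' + dl s' <= s + dl s)%nat by nia.
  assert (s' + dl s' = s + dl s -> s' < s)%nat by (intros E; rewrite E in H2; lia).
  assert (s' <> s) by (intros ->; lia).
  lia.
Qed.

(** Earlier pending rounds reach [s] by their own delay, and later ones are reached by the delay of
    [s]: at most [c] on each side. *)
Lemma pending_count_le (c s : nat) :
  (forall d, INR d < beta -> (d <= c)%nat) -> (s < n)%nat -> act s = true ->
  sumR n (fun s' => if pending s' s then 1 else 0) <= INR (c + c).
Proof.
  intros Hc Hs Hact; apply fed_spec in Hact as [_ [_ Hd]]; apply Hc in Hd.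
  apply Rle_trans with
    (sumR n (fun i => if ((s - c <=? i) && (i <? s))%nat then 1 else 0) +
     sumR n (fun i => if ((S s <=? i) && (i <? S s + c))%nat then 1 else 0)).
  - rewrite <- sumR_plus; apply sumR_le; intros s' Hs'.
    destruct (pending s' s) eqn:E.
    + apply pending_cases in E as [Hf [[H _]|[H _]]]; try assumption.
      * apply fed_spec in Hf as [_ [_ Hd']]; apply Hc in Hd'.
        destruct (Nat.leb_spec (s - c) s'), (Nat.ltb_spec s' s); try lia; cbn [andb].
        destruct (S s <=? s')%nat, (s' <? S s + c)%nat; cbn [andb]; lra.
      * destruct (Nat.leb_spec (S s) s'), (Nat.ltb_spec s' (S s + c)); try lia; cbn [andb].
        destruct (s - c <=? s')%nat, (s' <? s)%nat; cbn [andb]; lra.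
    + destruct (s - c <=? s')%nat, (s' <? s)%nat, (S s <=? s')%nat, (s' <? S s + c)%nat;
        cbn [andb]; lra.
  - rewrite plus_INR; apply Rplus_le_compat;
      (eapply Rle_trans; [apply sumR_interval_le | apply le_INR; lia]).
Qed.

Lemma prob_hdist_fed (A : nat -> nat) (s a : nat) : (s < n)%nat -> act s = true ->
  p A s a = hdist n act key K (x A) eta (s * n) a.
Proof.
  intros Hs Hact; apply fed_spec in Hact as [H1 [He _]].
  rewrite (prob_hdist K dl loss A T) by (unfold n in Hs; lia).
  rewrite He; reflexivity.
Qed.

Lemma eta_exp1 : eta * exp 1 = / (4 * beta).
Proof.
  unfold eta; rewrite eta'_m_beta; fold beta.
  pose proof (exp_pos 1); pose proof (beta_m_gt0 K m K_ge2) as Hb; fold beta in Hb.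
  field; split; lra.
Qed.

(* Fewer than 2 beta rounds are pending, and processing one of them shrinks the total
   weight by a factor at least 1 - eta e = 1 - 1/(4 beta), by the same bound for that round. *)
Lemma processing_dist_le (A : nat -> nat) (s a : nat) :
  (s < n)%nat -> (a < K)%nat -> act s = true -> q A s a <= exp 1 * p A s a.
Proof.
  remember (key s) as k eqn:Ek; revert s a Ek.
  induction k as [k IH] using (well_founded_induction Nat.lt_wf_0).
  intros s a -> Hs Ha Hact.
  pose proof (exp_pos 1) as He.
  pose proof (beta_m_gt0 K m K_ge2) as Hbeta; fold beta in Hbeta.
  rewrite prob_hdist_fed by assumption.
  destruct (max_nat_below beta) as [c [Hc1 Hc2]].
  pose proof (hpot_decay n act key arrival_key_inj K (x A) eta
    ltac:(lia) (eta'_m_gt0 K m K_ge2) (exp 1) (s * n) (key s) (key_ge s)) as Hdecay.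
  rewrite psum_diff in Hdecay by apply key_ge.
  fold act in Hdecay.
  change (sumR n _) with (sumR n (fun s' => if pending s' s then 1 else 0)) in Hdecay.
  set (N := sumR n (fun s' => if pending s' s then 1 else 0)) in *.
  assert (HN : N <= INR (c + c)) by (apply pending_count_le; assumption).
  assert (HN0 : 0 <= N) by (apply sumR_ge0; intros; destruct (pending i s); lra).
  rewrite eta_exp1 in Hdecay.
  assert (Hpot : hpot n act key K (x A) eta (s * n)
                 <= exp 1 * hpot n act key K (x A) eta (key s)).
  { pose proof (hpot_gt0 n act key K (x A) eta ltac:(lia) (s * n)) as Hp1.
    pose proof (hpot_gt0 n act key K (x A) eta ltac:(lia) (key s)) as Hp2.
    apply Rle_trans with (exp 1 * (hpot n act key K (x A) eta (s * n) * exp (- (1)))).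
    - rewrite (Rmult_comm _ (exp (- (1)))), <- Rmult_assoc, <- exp_plus.
      rewrite Rplus_opp_r, exp_0; lra.
    - apply Rmult_le_compat_l; [lra|].
      eapply Rle_trans; [|apply Hdecay].
      + apply Rmult_le_compat_l; [lra|]; apply exp_monotone.
        rewrite plus_INR in HN.
        assert (INR c <= beta).
        { destruct c as [|c]; [simpl; lra|]; left; apply Hc2; lia. }
        (* At most [2 * c <= 2 * beta] items at [1 / (2 * beta)] each make the exponent at most
           1. *)
        replace (- (2 * / (4 * beta)) * N) with (- (N / (2 * beta))) by (field; lra).
        apply Ropp_le_contravar, (Rmult_le_reg_r (2 * beta)); [lra|].
        unfold Rdiv; rewrite Rmult_assoc, Rinv_l by lra; lra.
      + intros s' Hs' Hact' Hk; split.
        * assert (Hp : pending s' s = true).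
          { unfold pending; fold act; rewrite Hact'; cbn [andb].
            apply andb_true_intro; split;
              [apply Nat.leb_le; lia | apply Nat.ltb_lt; lia]. }
          apply pending_cases in Hp as [_ Hp]; try assumption.
          (* Since a pending round exists, one of the two forwarded delays is at least 1, and it is
             below [beta]. Hence [eta * e = 1 / (4 * beta) <= 1 / 2]. *)
          assert (1 <= beta).
          { destruct Hp as [[Hp _]|[Hp _]].
            - apply fed_spec in Hact' as [_ [_ Hd]].
              assert (1 <= INR (dl s')) by (apply (le_INR 1); lia).
              fold beta in Hd; lra.
            - apply fed_spec in Hact as [_ [_ Hd]].
              assert (1 <= INR (dl s)) by (apply (le_INR 1); lia).
              fold beta in Hd; lra. }
          split; [left; apply Rinv_0_lt_compat; lra|].
          replace (1 / 2) with (/ 2) by field.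
          apply Rinv_le_contravar; lra.
        * apply Rle_trans with
            (sumR K (fun b => exp 1 * (if (b =? A s')%nat then 1 else 0))).
          -- apply sumR_le; intros b Hb.
             apply Rle_trans with (exp 1 * p A s' b * x A s' b).
             ++ apply Rmult_le_compat_r; [now apply est_loss_ge0|].
                apply (IH (key s')); [lia | reflexivity | assumption..].
             ++ rewrite Rmult_assoc; apply Rmult_le_compat_l; [lra|].
                now apply prob_est_loss_le.
          -- rewrite sumR_scal; pose proof (sumR_indicator_le1 K (A s')); nra. }
  apply (Rmult_le_reg_r (hpot n act key K (x A) eta (key s)));
    [apply hpot_gt0; lia|].
  eapply Rle_trans; [apply (hdist_le n act key K (x A) eta) with (k := (s * n)%nat)|].
  - lia.
  - apply est_loss_ge0.
  - now apply eta'_m_gt0.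
  - exact Ha.
  - apply key_ge.
  - pose proof (hdist_gt0 n act key K (x A) eta ltac:(lia) (s * n) a); nra.
Qed.

(** The standard bound concerns [q]. Its first moment is at least that of [p] minus the drift, which
    produces the cross terms over pending rounds; in its second moment, [q <= e p] and [p * x <= 1]
    remove one of the two factors [x]. *)
Lemma delayed_hedge_regret (A : nat -> nat) (a : nat) : (a < K)%nat ->
  asum n act (fun s => sumR K (fun b => p A s b * x A s b)) <=
  ln (INR K) / eta + asum n act (fun s => x A s a)
  + eta * exp 1 / 2 * asum n act (fun s => sumR K (x A s))
  + eta * asum n act (fun s => sumR n (fun s' =>
      if pending s' s then sumR K (fun b => x A s b * (p A s b * x A s' b)) else 0)).
Proof.
  intros Ha.
  pose proof (exp_pos 1) as He.
  pose proof (eta'_m_gt0 K m K_ge2) as Heta; fold eta in Heta.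
  pose proof (hedge_regret n act key arrival_key_inj K (x A) eta
    ltac:(lia) (est_loss_ge0 A) (eta'_m_gt0 K m K_ge2) a Ha) as H.
  set (pend := asum n act (fun s => sumR n (fun s' =>
      if pending s' s then sumR K (fun b => x A s b * (p A s b * x A s' b)) else 0))) in *.
  apply Rle_trans with
    (asum n act (fun s => sumR K (fun b => q A s b * x A s b)) + eta * pend).
  - unfold pend; rewrite <- asum_scal, <- asum_plus.
    apply asum_le; intros s Hs Hact.
    rewrite <- sumR_scal.
    rewrite (sumR_ext n _ (fun s' => sumR K (fun b => if pending s' s then
      eta * (x A s b * (p A s b * x A s' b)) else 0))).
    + rewrite sumR_swap, <- sumR_plus; apply sumR_le; intros b Hb.
      pose proof (est_loss_ge0 A s b Hs Hb Hact) as Hx.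
      pose proof (hdist_ge n act key K (x A) eta ltac:(lia) (est_loss_ge0 A) (eta'_m_gt0 K m K_ge2)
        (s * n) (key s) b Hb (key_ge s)) as Hq.
      rewrite psum_diff, <- prob_hdist_fed in Hq by (assumption || apply key_ge).
      rewrite (sumR_ext n _ (fun s' => eta * (x A s b * p A s b) *
        (if pending s' s then x A s' b else 0)))
        by (intros i _; destruct (pending i s); ring).
      rewrite sumR_scal.
      change (fun s0 => if act s0 && _ then x A s0 b else 0)
        with (fun s' => if pending s' s then x A s' b else 0) in Hq.
      set (D := sumR n _) in *.
      apply (Rmult_le_compat_r _ _ _ Hx) in Hq; lra.
    + intros s' _; destruct (pending s' s).
      * now rewrite sumR_scal.
      * rewrite sumR_0 by reflexivity; ring.
  - assert (asum n act (fun s => sumR K (fun b => q A s b * x A s b ^ 2))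
            <= exp 1 * asum n act (fun s => sumR K (x A s))).
    { rewrite <- asum_scal; apply asum_le; intros s Hs Hact.
      rewrite <- sumR_scal; apply sumR_le; intros b Hb.
      pose proof (est_loss_ge0 A s b Hs Hb Hact) as Hx.
      pose proof (processing_dist_le A s b Hs Hb Hact) as Hq.
      pose proof (prob_est_loss_le A s b Hs Hb Hact) as Hp.
      assert (p A s b * x A s b <= 1) by (destruct (b =? A s)%nat; lra).
      apply Rle_trans with (exp 1 * (p A s b * x A s b) * x A s b).
      - replace (q A s b * x A s b ^ 2) with (q A s b * x A s b * x A s b) by ring.
        rewrite <- Rmult_assoc.
        apply Rmult_le_compat_r, Rmult_le_compat_r; assumption.
      - apply Rmult_le_compat_r; [exact Hx | nra]. }
    nra.
Qed.

(** Each pair is charged to its earlier round, whose delay reaches the later one. A pair is counted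
    once, because the processing order decides which of its rounds is pending for the other. *)
Lemma pending_total_le :
  asum n act (fun s => sumR n (fun s' => if pending s' s then 1 else 0))
  <= asum n act (fun s => INR (dl s)).
Proof.
  set (G := fun s' s => if act s && pending s' s then 1 else 0).
  set (G1 := fun s' s => if (s' <? s)%nat then G s' s else 0).
  set (G2 := fun s' s => if (s <? s')%nat then G s' s else 0).
  apply Rle_trans with
    (sumR n (fun s => sumR n (fun s' => G1 s' s)) + sumR n (fun s => sumR n (fun s' => G2 s' s))).
  - rewrite <- sumR_plus; apply sumR_le; intros s Hs.
    rewrite <- sumR_plus.
    destruct (act s) eqn:Hact.
    + apply sumR_le; intros s' Hs'; unfold G1, G2, G; rewrite Hact; cbn [andb].
      destruct (pending s' s) eqn:E.
      * apply pending_cases in E as [_ E]; try assumption.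
        destruct (Nat.ltb_spec s' s), (Nat.ltb_spec s s'); try lia; lra.
      * destruct (s' <? s)%nat, (s <? s')%nat; lra.
    + apply sumR_ge0; intros s' Hs'; unfold G1, G2, G; rewrite Hact; cbn [andb].
      destruct (s' <? s)%nat, (s <? s')%nat; lra.
  (* After the swap the outer index is the earlier round in both halves. *)
  - rewrite sumR_swap, <- sumR_plus; apply sumR_le; intros s Hs.
    rewrite <- sumR_plus.
    apply Rle_trans with (sumR n (fun s' =>
      if act s && ((S s <=? s') && (s' <? S s + dl s))%nat then 1 else 0)).
    + apply sumR_le; intros s' Hs'; unfold G1, G2, G.
      destruct (Nat.ltb_spec s s') as [Hlt|_];
        [|destruct (act s && ((S s <=? s') && (s' <? S s + dl s))%nat); lra].
      destruct (act s' && pending s s') eqn:E1, (act s && pending s' s) eqn:E2.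
      * apply andb_prop in E1 as [_ E1]; apply andb_prop in E2 as [_ E2].
        apply pending_cases in E1 as [_ E1]; try assumption.
        apply pending_cases in E2 as [_ E2]; try assumption; lia.
      * apply andb_prop in E1 as [_ E1].
        apply pending_cases in E1 as [Hf E1]; try assumption.
        fold act in Hf; rewrite Hf.
        destruct (Nat.leb_spec (S s) s'), (Nat.ltb_spec s' (S s + dl s));
          try lia; cbn [andb]; lra.
      * apply andb_prop in E2 as [Hf E2]; rewrite Hf.
        apply pending_cases in E2 as [_ E2]; try assumption.
        destruct (Nat.leb_spec (S s) s'), (Nat.ltb_spec s' (S s + dl s));
          try lia; cbn [andb]; lra.
      * destruct (act s && ((S s <=? s') && (s' <? S s + dl s))%nat); lra.
    + destruct (act s).
      * cbn [andb]; eapply Rle_trans; [apply sumR_interval_le | apply le_INR; lia].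
      * rewrite sumR_0 by reflexivity; lra.
Qed.

Notation mean := (expect K dl loss T 1 (fun _ => 0%nat)).

Lemma mean_asum (f : nat -> (nat -> nat) -> R) :
  mean (fun A => asum n act (fun s => f s A)) = asum n act (fun s => mean (f s)).
Proof.
  unfold asum.
  rewrite (expect_sumR K dl loss ltac:(lia) T 1 _ n
    (fun s A => if act s then f s A else 0)) by lia.
  apply sumR_ext; intros s _; destruct (act s); [reflexivity|].
  apply expect_const; lia.
Qed.

Lemma mean_est_loss (s a : nat) (f : (nat -> nat) -> R) :
  (s < n)%nat -> act s = true -> (a < K)%nat ->
  (forall B c, f (upd B s c) = f B) ->
  (forall B u c, (s + dl s < u)%nat -> f (upd B u c) = f B) ->
  mean (fun A => x A s a * f A) = loss s a * mean f.
Proof.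
  intros Hs Hact Ha H1 H2; apply fed_spec in Hact as [Hs1 _]; unfold n in Hs.
  apply expect_est_loss; assumption || lia.
Qed.

Lemma mean_est_loss1 (s a : nat) : (s < n)%nat -> act s = true -> (a < K)%nat ->
  mean (fun A => x A s a) = loss s a.
Proof.
  intros Hs Hact Ha.
  rewrite (expect_ext K dl loss T 1 _ _ (fun A => x A s a * 1)) by (intros; ring).
  rewrite mean_est_loss by (reflexivity || assumption).
  rewrite expect_const by lia; ring.
Qed.

Lemma mean_prob_ge0 (s a : nat) : (1 <= s)%nat -> 0 <= mean (fun A => p A s a).
Proof.
  intros Hs; rewrite <- (expect_const K dl loss ltac:(lia) T 1 (fun _ => 0%nat) 0) by lia.
  apply expect_le; [lia | lia |]; intros; left; apply prob_gt0; lia.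
Qed.

Lemma mean_prob_sum1 (s : nat) : (1 <= s)%nat -> sumR K (fun a => mean (fun A => p A s a)) = 1.
Proof.
  intros Hs; rewrite <- (expect_sumR K dl loss ltac:(lia) T 1 _ K (fun a A => p A s a)) by lia.
  rewrite (expect_ext K dl loss T 1 _ _ (fun _ => 1))
    by (intros; apply prob_sum1; lia).
  apply expect_const; lia.
Qed.

(** Neither round is played with the feedback of the other, so the estimate of [s] and then that of
    [s'] integrate to true losses, each at most 1, and only [p_s] remains. *)
Lemma mean_cross_le (s' s b : nat) : (s < n)%nat -> (s' < n)%nat -> (b < K)%nat ->
  act s = true -> pending s' s = true ->
  mean (fun A => x A s b * (p A s b * x A s' b)) <= mean (fun A => p A s b).
Proof.
  intros Hs Hs' Hb Hact Hp.
  apply pending_cases in Hp as [Hact' Hp]; try assumption; fold act in Hact'.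
  destruct (fed_spec s Hact) as [Hs1 _]; destruct (fed_spec s' Hact') as [Hs1' _].
  rewrite (mean_est_loss s b (fun A => p A s b * x A s' b)) by
    (try assumption; intros; rewrite prob_upd, est_loss_upd by lia; reflexivity).
  rewrite (expect_ext K dl loss T 1 _ (fun A => p A s b * x A s' b)
    (fun A => x A s' b * p A s b)) by (intros; ring).
  rewrite (mean_est_loss s' b (fun A => p A s b)) by
    (try assumption; intros; rewrite prob_upd by lia; reflexivity).
  pose proof (mean_prob_ge0 s b Hs1); unfold n in *.
  destruct (loss_01 s b), (loss_01 s' b); try lia.
  set (r := expect _ _ _ _ _ _ _) in *.
  apply Rle_trans with (1 * (1 * r)); [|lra].
  apply Rmult_le_compat; nra.
Qed.

(** Expectation of [delayed_hedge_regret]: the [K] estimates of a round have total mean at most [K],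
    and a pending pair costs at most 1 because the mean probabilities of a round sum to 1. *)
Lemma fed_regret (a : nat) : (a < K)%nat ->
  asum n act (fun s => sumR K (fun b => loss s b * mean (fun A => p A s b))) <=
  ln (INR K) / eta + asum n act (fun s => loss s a)
  + eta * (exp 1 * INR K / 2 * asum n act (fun _ => 1)
           + asum n act (fun s => INR (dl s))).
Proof.
  intros Ha.
  pose proof (exp_pos 1) as He.
  pose proof (eta'_m_gt0 K m K_ge2) as Heta; fold eta in Heta.
  pose proof (expect_le K dl loss ltac:(lia) T 1 (fun _ => 0%nat) _ _ ltac:(lia)
    (fun A => delayed_hedge_regret A a Ha)) as H.
  rewrite !expect_plus, !expect_scal, expect_const, !mean_asum in H by lia.
  eapply Rle_trans; [|eapply Rle_trans; [exact H|]].
  - apply asum_le; intros s Hs Hact.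
    rewrite (expect_sumR K dl loss ltac:(lia) T 1 _ K (fun b A => p A s b * x A s b)) by lia.
    apply sumR_le; intros b Hb.
    rewrite (expect_ext K dl loss T 1 _ (fun A => p A s b * x A s b)
      (fun A => x A s b * p A s b)) by (intros; ring).
    rewrite (mean_est_loss s b (fun A => p A s b)) by
      (try assumption; intros; rewrite prob_upd by lia; reflexivity).
    lra.
  - rewrite Rmult_plus_distr_l, <- !Rplus_assoc.
    apply Rplus_le_compat; [apply Rplus_le_compat; [apply Rplus_le_compat|]|].
    + lra.
    + apply asum_le; intros s Hs Hact; rewrite mean_est_loss1 by assumption; lra.
    + replace (eta * (exp 1 * INR K / 2 * asum n act (fun _ => 1))) with
        (eta * exp 1 / 2 * asum n act (fun _ => INR K * 1))
        by (rewrite asum_scal; field).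
      apply Rmult_le_compat_l; [nra|].
      apply asum_le; intros s Hs Hact.
      rewrite <- sumR_const.
      rewrite (expect_sumR K dl loss ltac:(lia) T 1 _ K (fun b A => x A s b)) by lia.
      apply sumR_le; intros b Hb; rewrite mean_est_loss1 by assumption.
      apply fed_spec in Hact as [Hs1 _]; unfold n in Hs; apply loss_01; lia.
    + apply Rmult_le_compat_l; [lra|].
      eapply Rle_trans; [|apply pending_total_le].
      apply asum_le; intros s Hs Hact.
      rewrite (expect_sumR K dl loss ltac:(lia) T 1 _ n (fun s' A => if pending s' s
        then sumR K (fun b => x A s b * (p A s b * x A s' b)) else 0)) by lia.
      apply sumR_le; intros s' Hs'.
      destruct (pending s' s) eqn:E; [|rewrite expect_const by lia; lra].
      rewrite (expect_sumR K dl loss ltac:(lia) T 1 _ K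
        (fun b A => x A s b * (p A s b * x A s' b))) by lia.
      destruct (fed_spec s Hact) as [Hs1 _].
      rewrite <- (mean_prob_sum1 s Hs1).
      apply sumR_le; intros b Hb; now apply mean_cross_le.
Qed.

End Epoch.

(** * The epoch schedule *)

Section Doubling.

Variables (K : nat) (dl : nat -> nat).
Definition in_epoch (m s : nat) : bool := (1 <=? s)%nat && (epoch K dl s =? m)%nat.
Definition skipped (m s : nat) : bool := in_epoch m s && negb (isSmall K m (dl s)).

Definition stays (m : nat) (sg s D : R) : Prop :=
  s ^ 2 <= omega m /\ (exp 1 * INR K * sg / 2 + D) * ln (INR K) <= omega m.

Lemma condP (m sg s D : nat) :
  cond K m sg s D = true <-> stays m (INR sg) (INR s) (INR D).
Proof.
  unfold cond, leb_R, stays.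
  set (a := INR s ^ 2); set (b := _ * ln (INR K)).
  destruct (Rle_dec (Rmax a b) (omega m)) as [H|H].
  - split; [intros _ | reflexivity].
    pose proof (Rmax_l a b); pose proof (Rmax_r a b); lra.
  - split; [discriminate|]; intros [H1 H2]; exfalso; apply H.
    now apply Rmax_lub.
Qed.

Lemma isSmallP (m d : nat) : isSmall K m d = true <-> INR d < beta_m K m.
Proof.
  unfold isSmall, ltb_R; destruct (Rlt_dec (INR d) (beta_m K m)); split;
    intros; try reflexivity; try assumption; try discriminate; contradiction.
Qed.

Definition rounds (m t : nat) : R := asum (S t) (in_epoch m) (fun _ => 1).
Definition skips (m t : nat) : R := asum (S t) (skipped m) (fun _ => 1).
Definition fed_delay (m t : nat) : R := asum (S t) (fed K dl m) (fun s => INR (dl s)).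

Definition visited (m t : nat) : Prop :=
  exists i, (1 <= i <= t)%nat /\ epoch K dl i = m.

(* sg, s, D bound the statistics of epoch m including the round that closed it. *)
Definition left_by (m t : nat) : Prop :=
  exists sg s D, ~ stays m sg s D /\ sg <= INR t /\ 0 <= s /\
    s <= card_S t dl (beta_m K m) /\ D <= D_beta t dl (beta_m K m).

Lemma not_visited_asum (m t : nat) (act : nat -> bool) (f : nat -> R) :
  (forall s, act s = true -> in_epoch m s = true) -> ~ visited m t ->
  asum (S t) act f = 0.
Proof.
  intros Hact Hv; apply sumR_0; intros s Hs.
  destruct (act s) eqn:E; [|reflexivity]; exfalso; apply Hv; exists s.
  apply Hact, andb_prop in E as [H1 H2].
  apply Nat.leb_le in H1; apply Nat.eqb_eq in H2; split; [lia | exact H2].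
Qed.

Lemma fed_in_epoch (m s : nat) : fed K dl m s = true -> in_epoch m s = true.
Proof. unfold fed; intros H; now apply andb_prop in H as [H _]. Qed.

Lemma skipped_in_epoch (m s : nat) : skipped m s = true -> in_epoch m s = true.
Proof. unfold skipped; intros H; now apply andb_prop in H as [H _]. Qed.

Lemma in_epoch_eq (m s : nat) : (1 <= s)%nat -> in_epoch m s = (epoch K dl s =? m)%nat.
Proof. unfold in_epoch; intros H; apply Nat.leb_le in H; now rewrite H. Qed.

Lemma rounds_S (m t : nat) : rounds m (S t) =
  rounds m t + (if (epoch K dl (S t) =? m)%nat then 1 else 0).
Proof. unfold rounds; now rewrite asum_S, in_epoch_eq by lia. Qed.

Lemma skips_S (m t : nat) : skips m (S t) =
  skips m t + (if (epoch K dl (S t) =? m)%nat then INR (s1 K m (dl (S t))) else 0).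
Proof.
  unfold skips; rewrite asum_S; unfold skipped, s1; rewrite in_epoch_eq by lia.
  destruct (epoch K dl (S t) =? m)%nat, (isSmall K m (dl (S t))); reflexivity.
Qed.

Lemma fed_delay_S (m t : nat) : fed_delay m (S t) =
  fed_delay m t + (if (epoch K dl (S t) =? m)%nat then INR (D1 K m (dl (S t))) else 0).
Proof.
  unfold fed_delay; rewrite asum_S; fold (in_epoch m (S t)).
  unfold fed, D1; fold (in_epoch m (S t)); rewrite in_epoch_eq by lia.
  destruct (epoch K dl (S t) =? m)%nat, (isSmall K m (dl (S t))); reflexivity.
Qed.

Lemma counts_0 (m : nat) : rounds m 0 = 0 /\ skips m 0 = 0 /\ fed_delay m 0 = 0.
Proof. unfold rounds, skips, fed_delay, asum; simpl; repeat split; ring. Qed.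

Lemma rounds_le (m t : nat) : rounds m t <= INR t.
Proof.
  induction t as [|t IH]; [destruct (counts_0 m) as [-> _]; simpl; lra|].
  rewrite rounds_S, S_INR; destruct (_ =? _)%nat; lra.
Qed.

Lemma s1_eq (m d : nat) :
  INR (s1 K m d) = if Rle_dec (beta_m K m) (INR d) then 1 else 0.
Proof.
  unfold s1; pose proof (isSmallP m d) as H.
  destruct (isSmall K m d), (Rle_dec (beta_m K m) (INR d)); try reflexivity.
  - destruct H as [H _]; specialize (H eq_refl); lra.
  - destruct H as [_ H]; discriminate H; lra.
Qed.

Lemma D1_eq (m d : nat) :
  INR (D1 K m d) = if Rlt_dec (INR d) (beta_m K m) then INR d else 0.
Proof.
  unfold D1; pose proof (isSmallP m d) as H.
  destruct (isSmall K m d), (Rlt_dec (INR d) (beta_m K m)); try reflexivity.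
  - destruct H as [H _]; specialize (H eq_refl); lra.
  - destruct H as [_ H]; discriminate H; lra.
Qed.

Lemma card_S_S (t : nat) (b : R) : card_S (S t) dl b =
  card_S t dl b + (if Rle_dec b (INR (dl (S t))) then 1 else 0).
Proof. reflexivity. Qed.

Lemma D_beta_S (t : nat) (b : R) : D_beta (S t) dl b =
  D_beta t dl b + (if Rlt_dec (INR (dl (S t))) b then INR (dl (S t)) else 0).
Proof. reflexivity. Qed.

Lemma skips_le (m t : nat) : skips m t <= card_S t dl (beta_m K m).
Proof.
  induction t as [|t IH]; [destruct (counts_0 m) as [_ [-> _]]; unfold card_S; simpl; lra|].
  rewrite skips_S, card_S_S, <- s1_eq.
  pose proof (pos_INR (s1 K m (dl (S t)))); destruct (_ =? _)%nat; lra.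
Qed.

Lemma fed_delay_le (m t : nat) : fed_delay m t <= D_beta t dl (beta_m K m).
Proof.
  induction t as [|t IH]; [destruct (counts_0 m) as [_ [_ ->]]; unfold D_beta; simpl; lra|].
  rewrite fed_delay_S, D_beta_S, <- D1_eq.
  pose proof (pos_INR (D1 K m (dl (S t)))); destruct (_ =? _)%nat; lra.
Qed.

Lemma left_by_S (m t : nat) : left_by m t -> left_by m (S t).
Proof.
  intros [sg [s [D [H [H1 [H0 [H2 H3]]]]]]]; exists sg, s, D.
  rewrite S_INR, card_S_S, D_beta_S, <- s1_eq, <- D1_eq.
  pose proof (pos_INR (s1 K m (dl (S t)))); pose proof (pos_INR (D1 K m (dl (S t)))).
  repeat split; [exact H | lra | exact H0 | lra | lra].
Qed.

Lemma epoch_estate (t m sg s D : nat) : estate K dl t = (m, sg, s, D) -> epoch K dl t = m.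
Proof. unfold epoch; now intros ->. Qed.

Hypothesis K_ge2 : (2 <= K)%nat.

Lemma beta_m_ln (m : nat) : 4 * exp 1 * beta_m K m * ln (INR K) = sqrt (omega m).
Proof.
  pose proof (ln_K_gt0 K K_ge2); pose proof (exp_pos 1).
  unfold beta_m; field; split; lra.
Qed.

(** Half of [omega m] pays for [e K ln K / 2]. The other half pays for the delay: a forwarded [d]
    has [d ln K < beta_m ln K = sqrt (omega m) / (4 e)], and a skipped one adds only 1 to the count.
    So such an index accepts any delay. *)
Lemma single_round_stays (m d : nat) :
  exp 1 * INR K * ln (INR K) <= omega m -> cond K m 1 (s1 K m d) (D1 K m d) = true.
Proof.
  intros H; apply condP; unfold stays, s1, D1.
  pose proof (ln_K_gt0 K K_ge2) as HL; pose proof exp1_bounds as He.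
  pose proof (omega_ge1 m) as Ho; pose proof (sqrt_omega_le m) as Hs.
  pose proof (beta_m_ln m) as Hb.
  set (L := ln (INR K)) in *; set (e := exp 1) in *; set (k := INR K) in *.
  destruct (isSmall K m d) eqn:E.
  - apply isSmallP in E.
    assert (INR d * L <= beta_m K m * L) by (apply Rmult_le_compat_r; lra).
    assert (0 < beta_m K m * L)
      by (apply Rmult_lt_0_compat; [now apply beta_m_gt0 | exact HL]).
    assert (8 * (beta_m K m * L) <= 4 * e * (beta_m K m * L))
      by (apply Rmult_le_compat_r; lra).
    simpl (INR 0); simpl (INR 1); split; lra.
  - simpl (INR 0); simpl (INR 1); split; lra.
Qed.

Lemma search_spec (d fuel m : nat) :
  (exists j, (m <= j <= m + fuel)%nat /\ cond K j 1 (s1 K j d) (D1 K j d) = true) ->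
  let r := search K d m fuel in
  (m <= r)%nat /\ cond K r 1 (s1 K r d) (D1 K r d) = true /\
  (forall j, (m <= j < r)%nat -> cond K j 1 (s1 K j d) (D1 K j d) = false).
Proof.
  revert m; induction fuel as [|fuel IH]; intros m [j [Hj Hc]]; cbn [search].
  - replace j with m in Hc by lia; repeat split; [lia | exact Hc | lia].
  - destruct (cond K m 1 (s1 K m d) (D1 K m d)) eqn:E.
    + repeat split; [lia | exact E | lia].
    + destruct (IH (S m)) as [H1 [H2 H3]].
      * exists j; split; [|exact Hc].
        destruct (Nat.eq_dec j m) as [->|]; [congruence | lia].
      * repeat split; [lia | exact H2|].
        intros i Hi; destruct (Nat.eq_dec i m) as [->|]; [exact E | apply H3; lia].
Qed.

(** The fuel suffices because [2 ^ fuel >= fuel], and [fuel] is at least what a single round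
    requires. By [single_round_stays], only indices with small [omega] can be passed over. *)
Lemma next_index_spec (m d : nat) :
  let r := next_index K m d in
  (m < r)%nat /\ cond K r 1 (s1 K r d) (D1 K r d) = true /\
  (forall j, (m < j < r)%nat -> omega j < exp 1 * INR K * ln (INR K)).
Proof.
  unfold next_index; set (fuel := ((2 * K + d) * K)%nat).
  destruct (search_spec d fuel (S m)) as [H1 [H2 H3]].
  - exists (S m + fuel)%nat; split; [lia|].
    assert (Hf : (exp 1 * INR K / 2 + INR d) * ln (INR K) <= INR fuel).
    { unfold fuel; rewrite mult_INR, plus_INR, mult_INR; simpl (INR 2).
      assert (HK : 2 <= INR K) by (apply (le_INR 2); lia).
      pose proof (ln_le_sub_1 (INR K) ltac:(lra)).
      pose proof (ln_K_gt0 K K_ge2); pose proof exp1_bounds; pose proof (pos_INR d).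
      apply Rmult_le_compat; nra. }
    pose proof (omega_ge1 (S m + fuel)) as Ho.
    assert (Hw : INR fuel <= omega (S m + fuel)).
    { eapply Rle_trans; [apply INR_le_pow2|]; apply Rle_pow; [lra|lia]. }
    apply condP; unfold stays; split.
    + unfold s1; destruct (isSmall _ _ _); [simpl (INR 0) | simpl (INR 1)]; lra.
    + eapply Rle_trans; [|eapply Rle_trans; [exact Hf | exact Hw]].
      apply Rmult_le_compat_r; [left; now apply ln_K_gt0|].
      assert (INR (D1 K (S m + fuel) d) <= INR d).
      { unfold D1; destruct (isSmall _ _ _); [lra | apply pos_INR]. }
      simpl (INR 1); lra.
  - repeat split; [lia | exact H2|].
    intros j Hj; destruct (Rlt_dec (omega j) (exp 1 * INR K * ln (INR K))); [assumption|].
    specialize (H3 j ltac:(lia)); rewrite single_round_stays in H3 by lra; discriminate.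
Qed.

(** Passing over [S m] would force [2 * omega m < e K ln K]. The stay condition of an epoch that
    contains a round yields the hypothesis, so only the first epoch can jump. *)
Lemma next_index_succ (m d : nat) :
  exp 1 * INR K * ln (INR K) / 2 <= omega m -> next_index K m d = S m.
Proof.
  intros H; destruct (next_index_spec m d) as [H1 [_ H3]].
  destruct (Nat.eq_dec (next_index K m d) (S m)) as [E|]; [exact E|].
  specialize (H3 (S m) ltac:(lia)); rewrite omega_S in H3; lra.
Qed.

(** [omega 0 = 1], while a single round already requires [e K ln K / 2 > 1]. The initial state of
    index 0 therefore never becomes an epoch. *)
Lemma first_round_new_epoch (d : nat) :
  cond K 0 1 (0 + s1 K 0 d) (0 + D1 K 0 d) = false.
Proof.
  destruct (cond K 0 1 (0 + s1 K 0 d) (0 + D1 K 0 d)) eqn:E; [|reflexivity].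
  exfalso; apply condP in E as [_ E]; unfold omega in E; simpl (INR 1) in E; simpl (2 ^ 0) in E.
  assert (HK : 2 <= INR K) by (apply (le_INR 2); lia).
  pose proof exp1_bounds.
  assert (/ 2 < ln (INR K)).
  { apply Rlt_le_trans with (1 := ln_lt_2).
    destruct HK as [HK | <-]; [left; apply ln_increasing; lra | lra]. }
  assert (1 < exp 1 * ln (INR K)) by nra.
  pose proof (pos_INR (0 + D1 K 0 d)); nra.
Qed.

(** The third clause keeps the stay condition of closed epochs too, for their regret bounds. The
    last one remembers the violation that ended the predecessor of the current epoch, which yields
    the lower bound on the tradeoff. *)
Definition schedule_inv (t : nat) : Prop :=
  let '(m, sg, s, D) := estate K dl t in
  (INR sg = rounds m t /\ INR s = skips m t /\ INR D = fed_delay m t) /\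
  (forall i, (1 <= i <= t)%nat -> (epoch K dl 1 <= epoch K dl i <= m)%nat) /\
  (forall m', visited m' t -> stays m' (rounds m' t) (skips m' t) (fed_delay m' t)) /\
  (m = epoch K dl 1 \/ exists m', m = S m' /\ left_by m' t).

Lemma schedule_inv_1 : schedule_inv 1.
Proof.
  unfold schedule_inv.
  pose proof (epoch_estate 1 (next_index K 0 (dl 1%nat)) 1
    (s1 K (next_index K 0 (dl 1%nat)) (dl 1%nat))
    (D1 K (next_index K 0 (dl 1%nat)) (dl 1%nat))) as He.
  cbn [estate] in *; rewrite first_round_new_epoch in *; specialize (He eq_refl).
  destruct (next_index_spec 0 (dl 1%nat)) as [_ [Hc _]].
  set (m := next_index K 0 (dl 1%nat)) in *.
  destruct (counts_0 m) as [C1 [C2 C3]].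
  assert (Hr : INR 1 = rounds m 1)
    by (rewrite rounds_S, C1, He, Nat.eqb_refl; simpl; ring).
  assert (Hs : INR (s1 K m (dl 1%nat)) = skips m 1)
    by (rewrite skips_S, C2, He, Nat.eqb_refl; ring).
  assert (HD : INR (D1 K m (dl 1%nat)) = fed_delay m 1)
    by (rewrite fed_delay_S, C3, He, Nat.eqb_refl; ring).
  repeat split; try assumption.
  - replace i with 1%nat by lia; lia.
  - replace i with 1%nat by lia; lia.
  - apply condP in Hc; destruct H as [i [Hi <-]]; replace i with 1%nat by lia.
    rewrite He, <- Hs; apply Hc.
  - apply condP in Hc; destruct H as [i [Hi <-]]; replace i with 1%nat by lia.
    rewrite He, <- Hr, <- HD; apply Hc.
  - left; now symmetry.
Qed.

Lemma schedule_inv_S (t : nat) : (1 <= t)%nat -> schedule_inv t -> schedule_inv (S t).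
Proof.
  unfold schedule_inv; intros Ht.
  destruct (estate K dl t) as [[[m sg] s] D] eqn:Et.
  intros [[Hr [Hs HD]] [Hmono [Hstays Hlast]]].
  pose proof (epoch_estate _ _ _ _ _ Et) as Ht_m.
  assert (Hother : forall m', epoch K dl (S t) <> m' -> visited m' (S t) ->
    stays m' (rounds m' (S t)) (skips m' (S t)) (fed_delay m' (S t))).
  { intros m' Hne [i [Hi Hm']].
    rewrite rounds_S, skips_S, fed_delay_S.
    destruct (Nat.eqb_spec (epoch K dl (S t)) m'); [contradiction|].
    rewrite !Rplus_0_r; apply Hstays; exists i; split; [|exact Hm'].
    destruct (Nat.eq_dec i (S t)) as [->|]; [contradiction | lia]. }
  cbn [estate]; rewrite Et; set (d := dl (S t)).
  destruct (cond K m (S sg) (s + s1 K m d) (D + D1 K m d)) eqn:Ec.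
  - assert (He : epoch K dl (S t) = m).
    { unfold epoch; cbn [estate]; rewrite Et; fold d; now rewrite Ec. }
    assert (Hr' : INR (S sg) = rounds m (S t))
      by (rewrite rounds_S, He, Nat.eqb_refl, S_INR, Hr; ring).
    assert (Hs' : INR (s + s1 K m d) = skips m (S t))
      by (rewrite skips_S, He, Nat.eqb_refl, plus_INR, Hs; reflexivity).
    assert (HD' : INR (D + D1 K m d) = fed_delay m (S t))
      by (rewrite fed_delay_S, He, Nat.eqb_refl, plus_INR, HD; reflexivity).
    split; [repeat split; assumption|]; split; [|split].
    + intros i Hi; destruct (Nat.eq_dec i (S t)) as [->|]; [|apply Hmono; lia].
      rewrite He; specialize (Hmono t); lia.
    + intros m' Hv; destruct (Nat.eq_dec (epoch K dl (S t)) m') as [E|]; [|now apply Hother].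
      replace m' with m by congruence.
      rewrite <- Hr', <- Hs', <- HD'; now apply condP.
    + destruct Hlast as [H | [m' [Hm' Hl]]]; [now left | right].
      exists m'; split; [exact Hm' | now apply left_by_S].
  - assert (Hnext : next_index K m d = S m).
    { apply next_index_succ.
      destruct (Hstays m) as [_ H]; [exists t; split; [lia | exact Ht_m]|].
      assert (Hr1 : 1 <= rounds m t).
      { destruct t as [|t]; [lia|].
        rewrite rounds_S, Ht_m, Nat.eqb_refl.
        assert (0 <= rounds m t)
          by (apply sumR_ge0; intros i _; destruct (in_epoch m i); lra).
        lra. }
      assert (0 <= fed_delay m t)
        by (apply sumR_ge0; intros i _; destruct (fed K dl m i); [apply pos_INR | lra]).
      pose proof (ln_K_gt0 K K_ge2); pose proof exp1_bounds; pose proof (pos_INR K).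
      assert (exp 1 * INR K * 1 <= exp 1 * INR K * rounds m t)
        by (apply Rmult_le_compat_l; nra).
      assert (exp 1 * INR K / 2 <= exp 1 * INR K * rounds m t / 2 + fed_delay m t) by lra.
      nra. }
    destruct (next_index_spec m d) as [_ [Hc _]]; rewrite Hnext in *.
    assert (He : epoch K dl (S t) = S m).
    { unfold epoch; cbn [estate]; rewrite Et; fold d; now rewrite Ec, Hnext. }
    (* [S m] exceeds every index used so far, so the counts of the new epoch start from zero. *)
    assert (Hnv : ~ visited (S m) t).
    { intros [i [Hi Hm]]; specialize (Hmono i Hi); lia. }
    assert (Hr' : INR 1 = rounds (S m) (S t)).
    { rewrite rounds_S, He, Nat.eqb_refl; unfold rounds.
      rewrite (not_visited_asum (S m)) by (exact Hnv || auto); simpl; ring. }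
    assert (Hs' : INR (s1 K (S m) d) = skips (S m) (S t)).
    { rewrite skips_S, He, Nat.eqb_refl; unfold skips.
      rewrite (not_visited_asum (S m)) by (exact Hnv || apply skipped_in_epoch).
      fold d; ring. }
    assert (HD' : INR (D1 K (S m) d) = fed_delay (S m) (S t)).
    { rewrite fed_delay_S, He, Nat.eqb_refl; unfold fed_delay.
      rewrite (not_visited_asum (S m)) by (exact Hnv || apply fed_in_epoch).
      fold d; ring. }
    split; [repeat split; assumption|]; split; [|split].
    + intros i Hi; destruct (Nat.eq_dec i (S t)) as [->|].
      * rewrite He; specialize (Hmono 1%nat); lia.
      * specialize (Hmono i); lia.
    + intros m' Hv; destruct (Nat.eq_dec (epoch K dl (S t)) m') as [E|]; [|now apply Hother].
      replace m' with (S m) by congruence.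
      rewrite <- Hr', <- Hs', <- HD'; now apply condP.
    + right; exists m; split; [reflexivity|].
      exists (INR (S sg)), (INR (s + s1 K m d)), (INR (D + D1 K m d)).
      repeat split.
      * intros H; apply condP in H; congruence.
      * rewrite !S_INR, Hr; pose proof (rounds_le m t); lra.
      * apply pos_INR.
      * rewrite plus_INR, Hs, card_S_S, s1_eq; pose proof (skips_le m t); unfold d; lra.
      * rewrite plus_INR, HD, D_beta_S, D1_eq; pose proof (fed_delay_le m t); unfold d; lra.
Qed.

Lemma schedule_inv_all (t : nat) : (1 <= t)%nat -> schedule_inv t.
Proof.
  intros Ht; induction Ht as [|t Ht IH]; [apply schedule_inv_1 | now apply schedule_inv_S].
Qed.

(** A first index above 1 means that its predecessor was rejected, hence had [omega] below
    [e K ln K]. *)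
Lemma first_epoch_bound :
  epoch K dl 1 = 1%nat \/
  omega (epoch K dl 1) <= 2 * (exp 1 * INR K * ln (INR K)).
Proof.
  assert (He : epoch K dl 1 = next_index K 0 (dl 1%nat)).
  { unfold epoch; cbn [estate]; now rewrite first_round_new_epoch. }
  rewrite He; destruct (next_index_spec 0 (dl 1%nat)) as [H1 [_ H3]].
  destruct (next_index K 0 (dl 1%nat)) as [|[|m]]; [lia | now left | right].
  specialize (H3 (S m) ltac:(lia)); rewrite omega_S; lra.
Qed.

End Doubling.

(** * Total regret *)

Lemma card_S_ge0 (T : nat) (dl : nat -> nat) (b : R) : 0 <= card_S T dl b.
Proof. apply sumR_ge0; intros i _; destruct (Rle_dec _ _); lra. Qed.

Lemma D_beta_ge0 (T : nat) (dl : nat -> nat) (b : R) : 0 <= D_beta T dl b.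
Proof. apply sumR_ge0; intros i _; destruct (Rlt_dec _ _); [apply pos_INR | lra]. Qed.

Lemma card_S_antitone (T : nat) (dl : nat -> nat) (b b' : R) :
  b <= b' -> card_S T dl b' <= card_S T dl b.
Proof.
  intros H; apply sumR_le; intros i _.
  destruct (Rle_dec b' _), (Rle_dec b _); lra.
Qed.

(** A delay counted for [b'] but not for [b] lies between [b] and [b']: it belongs to [S_b] and is
    less than [b']. *)
Lemma D_beta_le (T : nat) (dl : nat -> nat) (b b' : R) : 0 <= b' ->
  D_beta T dl b' <= D_beta T dl b + b' * card_S T dl b.
Proof.
  intros H; unfold D_beta, card_S; rewrite <- sumR_scal, <- sumR_plus.
  apply sumR_le; intros i _; pose proof (pos_INR (dl (S i))).
  destruct (Rlt_dec _ b'), (Rlt_dec _ b), (Rle_dec b _); lra.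
Qed.

Definition tradeoff (K T : nat) (dl : nat -> nat) (b : R) : R :=
  card_S T dl b + 4 * exp 1 * b * ln (INR K)
  + (INR K * INR T + D_beta T dl b) / (4 * exp 1 * b).

Lemma tradeoff_terms_ge0 (K T : nat) (dl : nat -> nat) (b : R) : (2 <= K)%nat -> 0 < b ->
  0 <= card_S T dl b /\ 0 <= 4 * exp 1 * b * ln (INR K) /\
  0 <= (INR K * INR T + D_beta T dl b) / (4 * exp 1 * b).
Proof.
  intros HK Hb; pose proof (exp_pos 1); pose proof (ln_K_gt0 K HK).
  pose proof (D_beta_ge0 T dl b); pose proof (pos_INR K); pose proof (pos_INR T).
  repeat split; [apply card_S_ge0 | repeat apply Rmult_le_pos; lra |].
  apply Rmult_le_pos; [nra | left; apply Rinv_0_lt_compat; nra].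
Qed.

(** With [W], [C], [u] and [G] as in the proof, the tradeoff is [C + u + G / u]. If [b] exceeds
    [beta_m], then [u >= W]; if [C >= W], the first term suffices. Otherwise the number of skips is
    at most [C < W], so the violation comes from the other half of the condition:
    [W ^ 2 < 3 / 2 * G + beta_m * ln K * C], where [3 / 2] is a bound on [e / 2] and
    [beta_m * ln K = W / (4 e) <= W / 8]. This leaves [G >= (W - C) ^ 2 / 4]. *)
Lemma left_by_tradeoff (K T m : nat) (dl : nat -> nat) (b : R) :
  (2 <= K)%nat -> 0 < b -> left_by K dl m T -> sqrt (omega m) <= tradeoff K T dl b.
Proof.
  intros HK Hb [sg [s [D [Hstay [Hsg [Hs0 [Hs HD]]]]]]].
  destruct (tradeoff_terms_ge0 K T dl b HK Hb) as [H1 [H2 H3]].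
  pose proof (beta_m_ln K HK m) as Hbm; pose proof (beta_m_gt0 K m HK) as Hbm0.
  pose proof (ln_K_gt0 K HK) as HL; pose proof exp1_bounds as He.
  pose proof (sqrt_omega_sqr m) as Hw; pose proof (sqrt_omega_ge1 m) as HW.
  unfold tradeoff.
  destruct (Rlt_le_dec (beta_m K m) b) as [Hlt | Hle].
  - assert (4 * exp 1 * beta_m K m * ln (INR K) <= 4 * exp 1 * b * ln (INR K)).
    { apply Rmult_le_compat_r; [lra|]; apply Rmult_le_compat_l; lra. }
    lra.
  - pose proof (card_S_antitone T dl b (beta_m K m) Hle) as HC.
    pose proof (D_beta_le T dl b (beta_m K m) (Rlt_le _ _ Hbm0)) as HD'.
    set (C := card_S T dl b) in *; set (L := ln (INR K)) in *.
    set (W := sqrt (omega m)) in *; set (u := 4 * exp 1 * b * L) in *.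
    destruct (Rle_lt_dec W C) as [HWC | HCW]; [lra|].
    set (G := (INR K * INR T + D_beta T dl b) * L).
    assert (Hu : 0 < u) by (unfold u; repeat apply Rmult_lt_0_compat; lra).
    replace ((INR K * INR T + D_beta T dl b) / (4 * exp 1 * b)) with (G / u)
      by (unfold G, u; field; repeat split; lra).
    assert (HG : (W - C) ^ 2 / 4 <= G).
    { assert (Hno : omega m < (exp 1 * INR K * sg / 2 + D) * L).
      { apply Rnot_le_lt; intros Hle'; apply Hstay; split; [|exact Hle'].
        rewrite <- Hw; simpl; rewrite Rmult_1_r; apply Rmult_le_compat; lra. }
      assert (Hsmall : 8 * (beta_m K m * L) <= W).
      { rewrite <- Hbm; replace (4 * exp 1 * beta_m K m * L) with
          (4 * exp 1 * (beta_m K m * L)) by ring.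
        apply Rmult_le_compat_r; [apply Rmult_le_pos|]; lra. }
      pose proof (card_S_ge0 T dl b) as HC0; fold C in HC0.
      pose proof (D_beta_ge0 T dl b) as HD0.
      pose proof (pos_INR K) as HK0; pose proof (pos_INR T) as HT0.
      assert (HKT : INR K * sg <= INR K * INR T) by (apply Rmult_le_compat_l; lra).
      assert (HKT0 : 0 <= INR K * INR T) by (apply Rmult_le_pos; lra).
      assert (Hsum : exp 1 * INR K * sg / 2 + D
        <= 3 / 2 * (INR K * INR T + D_beta T dl b) + beta_m K m * C).
      { assert (exp 1 * (INR K * sg) <= exp 1 * (INR K * INR T))
          by (apply Rmult_le_compat_l; lra).
        assert (exp 1 * (INR K * INR T) <= 3 * (INR K * INR T))
          by (apply Rmult_le_compat_r; lra).
        lra. }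
      apply (Rmult_le_compat_r L) in Hsum; [|lra].
      replace ((3 / 2 * (INR K * INR T + D_beta T dl b) + beta_m K m * C) * L) with
        (3 / 2 * G + beta_m K m * L * C) in Hsum by (unfold G; ring).
      assert (8 * (beta_m K m * L) * C <= W * C) by (apply Rmult_le_compat_r; lra).
      assert (0 <= C * (W - C)) by (apply Rmult_le_pos; lra).
      nra. }
    apply (Rmult_le_reg_r u); [exact Hu|].
    replace ((C + u + G / u) * u) with (C * u + u * u + G) by (field; lra).
    (* AM-GM: C + u + G / u >= W because G >= (W - C)^2 / 4. *)
    assert (0 <= (u - (W - C) / 2) ^ 2) by apply pow2_ge_0.
    nra.
Qed.

Lemma round_regret_sum (K T : nat) (dl : nat -> nat) (r : nat -> R) :
  (2 <= K)%nat -> (1 <= T)%nat ->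
  sumR T (fun i => r (S i)) =
  sumR (S (epoch K dl T)) (fun m => asum (S T) (in_epoch K dl m) r).
Proof.
  intros HK HT.
  transitivity (sumR (S T) (fun s => if (1 <=? s)%nat then r s else 0)).
  - rewrite sumR_S_l; simpl (1 <=? 0)%nat; rewrite Rplus_0_l; reflexivity.
  - unfold asum; rewrite sumR_swap; apply sumR_ext; intros s Hs; unfold in_epoch.
    destruct (Nat.leb_spec 1 s) as [H1|_]; cbn [andb].
    + rewrite (sumR_ext _ _ (fun m => if (m =? epoch K dl s)%nat then r s else 0))
        by (intros; now rewrite Nat.eqb_sym).
      rewrite (sumR_delta _ _ (fun _ => r s)); [reflexivity|].
      pose proof (schedule_inv_all K dl HK T HT) as H; unfold schedule_inv in H.
      destruct (estate K dl T) as [[[m sg] s'] D] eqn:E.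
      rewrite (epoch_estate K dl T m sg s' D E).
      destruct H as [_ [H _]]; specialize (H s); lia.
    + symmetry; now apply sumR_0.
Qed.

Section Regret.

Variables (K T : nat) (loss : nat -> nat -> R) (dl : nat -> nat).
Hypothesis K_ge2 : (2 <= K)%nat.

Definition mean_prob (s b : nat) : R :=
  expect K dl loss T 1 (fun _ => 0%nat) (fun A => prob K dl loss A s b).

Lemma ev_mean : ev K dl loss T 1 (fun _ => 0%nat) =
  sumR T (fun i => sumR K (fun b => loss (S i) b * mean_prob (S i) b)).
Proof.
  rewrite ev_expect, (expect_sumR K dl loss ltac:(lia) T 1 _ T
    (fun i A => sumR K (fun b => prob K dl loss A (1 + i) b * loss (1 + i)%nat b))) by lia.
  apply sumR_ext; intros i _.
  rewrite (expect_sumR K dl loss ltac:(lia) T 1 _ K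
    (fun b A => prob K dl loss A (1 + i) b * loss (1 + i)%nat b)) by lia.
  apply sumR_ext; intros b _; unfold mean_prob; rewrite <- expect_scal.
  apply expect_ext; intros; simpl (1 + i)%nat; ring.
Qed.

Hypothesis loss_01 :
  forall t b, (1 <= t <= T)%nat -> (b < K)%nat -> 0 <= loss t b <= 1.
Variable a : nat.
Hypothesis a_lt : (a < K)%nat.

Definition round_regret (s : nat) : R :=
  sumR K (fun b => loss s b * mean_prob s b) - loss s a.

Lemma round_regret_le1 (s : nat) : (1 <= s <= T)%nat -> round_regret s <= 1.
Proof.
  intros Hs; unfold round_regret; rewrite <- (mean_prob_sum1 K T dl loss K_ge2 s) by lia.
  assert (sumR K (fun b => loss s b * mean_prob s b) <= sumR K (mean_prob s)).
  { apply sumR_le; intros b Hb; destruct (loss_01 s b Hs Hb).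
    pose proof (mean_prob_ge0 K T dl loss K_ge2 s b ltac:(lia)) as Hp.
    fold (mean_prob s b) in Hp; nra. }
  destruct (loss_01 s a Hs a_lt); unfold mean_prob in *; lra.
Qed.

Lemma epoch_regret (m : nat) :
  asum (S T) (in_epoch K dl m) round_regret <=
  skips K dl m T + ln (INR K) / eta'_m K m
  + eta'_m K m * (exp 1 * INR K * rounds K dl m T / 2 + fed_delay K dl m T).
Proof.
  assert (Hsplit : asum (S T) (in_epoch K dl m) round_regret =
    asum (S T) (fed K dl m) round_regret + asum (S T) (skipped K dl m) round_regret).
  { unfold asum; rewrite <- sumR_plus; apply sumR_ext; intros s _.
    unfold skipped, fed; fold (in_epoch K dl m s).
    destruct (in_epoch K dl m s), (isSmall K m (dl s)); simpl; ring. }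
  assert (Hskip : asum (S T) (skipped K dl m) round_regret <= skips K dl m T).
  { apply asum_le; intros s Hs H; apply round_regret_le1.
    apply skipped_in_epoch, andb_prop in H as [H _]; apply Nat.leb_le in H; lia. }
  assert (Hfed : asum (S T) (fed K dl m) round_regret =
    asum (S T) (fed K dl m) (fun s => sumR K (fun b => loss s b * mean_prob s b))
    - asum (S T) (fed K dl m) (fun s => loss s a)).
  { unfold asum; rewrite <- sumR_minus; apply sumR_ext; intros s _.
    unfold round_regret; destruct (fed K dl m s); ring. }
  assert (Hcount : asum (S T) (fed K dl m) (fun _ => 1) <= rounds K dl m T).
  { apply sumR_le; intros s _; pose proof (fed_in_epoch K dl m s) as H.
    destruct (fed K dl m s); [rewrite H by reflexivity; lra|].
    destruct (in_epoch K dl m s); lra. }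
  pose proof (fed_regret K T dl loss m K_ge2 loss_01 a a_lt) as H.
  fold mean_prob in H; change (asum (S T) (fed K dl m) (fun s => INR (dl s)))
    with (fed_delay K dl m T) in H.
  pose proof (eta'_m_gt0 K m K_ge2); pose proof (exp_pos 1); pose proof (pos_INR K).
  assert (eta'_m K m * (exp 1 * INR K / 2 * asum (S T) (fed K dl m) (fun _ => 1)
      + fed_delay K dl m T) <=
    eta'_m K m * (exp 1 * INR K * rounds K dl m T / 2 + fed_delay K dl m T)).
  { apply Rmult_le_compat_l; [lra|]; apply Rplus_le_compat_r.
    replace (exp 1 * INR K * rounds K dl m T / 2) with
      (exp 1 * INR K / 2 * rounds K dl m T) by field.
    apply Rmult_le_compat_l; [|exact Hcount].
    assert (0 <= exp 1 * INR K) by (apply Rmult_le_pos; lra); lra. }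
  unfold mean_prob in *; lra.
Qed.

(** Three terms of size at most [sqrt (omega m)]: the skips and the [eta] term by the two halves of
    the stay condition, and [ln K / eta], which equals it by the choice of the rate. *)
Lemma stays_regret (m : nat) :
  stays K m (rounds K dl m T) (skips K dl m T) (fed_delay K dl m T) ->
  asum (S T) (in_epoch K dl m) round_regret <= 3 * sqrt (omega m).
Proof.
  intros [H1 H2]; eapply Rle_trans; [apply epoch_regret|].
  rewrite eta'_m_eq by exact K_ge2.
  pose proof (sqrt_omega_sqr m) as Hw; pose proof (sqrt_omega_ge1 m) as HW.
  pose proof (ln_K_gt0 K K_ge2) as HL.
  set (W := sqrt (omega m)) in *; set (L := ln (INR K)) in *.
  set (X := exp 1 * INR K * rounds K dl m T / 2 + fed_delay K dl m T) in *.
  assert (Hs : skips K dl m T <= W) by (apply Rnot_lt_le; intros Hlt; nra).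
  replace (L / (L / W)) with W by (field; split; lra).
  assert (L / W * X <= W).
  { apply (Rmult_le_reg_r W); [lra|].
    replace (L / W * X * W) with (X * L) by (field; lra); lra. }
  lra.
Qed.

(** Every index from the first epoch on is charged its full bound; an index visited by no round has
    an empty sum. *)
Lemma epoch_regret_sum : (1 <= T)%nat ->
  sumR T (fun i => round_regret (S i)) <=
  sumR (S (epoch K dl T)) (fun m =>
    if (epoch K dl 1 <=? m)%nat then 3 * sqrt (omega m) else 0).
Proof.
  intros HT; rewrite (round_regret_sum K T dl _ K_ge2 HT).
  apply sumR_le; intros m Hm.
  pose proof (schedule_inv_all K dl K_ge2 T HT) as Hinv; unfold schedule_inv in Hinv.
  destruct (estate K dl T) as [[[M sg] s] D] eqn:E.
  destruct Hinv as [_ [Hmono [Hstays _]]].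
  assert (Hempty : ~ visited K dl m T -> asum (S T) (in_epoch K dl m) round_regret = 0)
    by (intros H; apply (not_visited_asum K dl m); [auto | exact H]).
  pose proof (sqrt_pos (omega m)).
  destruct (Nat.leb_spec (epoch K dl 1) m) as [Hle|Hlt].
  - destruct (existsb (fun i => (epoch K dl i =? m)%nat) (seq 1 T)) eqn:Ev.
    + apply stays_regret, Hstays.
      apply existsb_exists in Ev as [i [Hi Hm']].
      apply in_seq in Hi; apply Nat.eqb_eq in Hm'; exists i; split; [lia | exact Hm'].
    + rewrite Hempty; [lra|]; intros [i [Hi Hm']].
      assert (existsb (fun i => (epoch K dl i =? m)%nat) (seq 1 T) = true); [|congruence].
      apply existsb_exists; exists i; split; [apply in_seq; lia | now apply Nat.eqb_eq].
  - rewrite Hempty; [lra|]; intros [i [Hi Hm']].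
    specialize (Hmono i Hi); lia.
Qed.

End Regret.

Theorem theorem6 (K T : nat) (hK : (2 <= K)%nat) (hT : (1 <= T)%nat)
  (loss : nat -> nat -> R) (dl : nat -> nat)
  (hloss : forall t a, (1 <= t <= T)%nat -> (a < K)%nat -> 0 <= loss t a <= 1) :
  forall beta : R, 0 < beta ->
  exp_regret K T dl loss <=
    15 * (card_S T dl beta + 4 * exp 1 * beta * ln (INR K)
          + (INR K * INR T + D_beta T dl beta) / (4 * exp 1 * beta))
    + 10 * (exp 1) ^ 2 * INR K * ln (INR K) + 5.
Proof.
  intros beta Hbeta; fold (tradeoff K T dl beta); unfold exp_regret.
  destruct (minR_attained K (fun a => sumR T (fun i => loss (S i) a)))
    as [a [Ha ->]]; [lia|].
  rewrite ev_mean, <- sumR_minus by exact hK.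
  change (sumR T _) with (sumR T (fun i => round_regret K T loss dl a (S i))).
  eapply Rle_trans; [now apply epoch_regret_sum|].
  destruct (tradeoff_terms_ge0 K T dl beta hK Hbeta) as [F1 [F2 F3]].
  assert (HF : 0 <= tradeoff K T dl beta) by (unfold tradeoff; lra).
  assert (HKL : 0 < INR K * ln (INR K)).
  { apply Rmult_lt_0_compat; [apply (lt_INR 0); lia | now apply ln_K_gt0]. }
  pose proof exp1_bounds as He.
  assert (HeKL : 0 <= 10 * exp 1 ^ 2 * INR K * ln (INR K)).
  { rewrite !Rmult_assoc; apply Rmult_le_pos; [lra|].
    apply Rmult_le_pos; [apply pow2_ge_0 | lra]. }
  pose proof (schedule_inv_all K dl hK T hT) as Hinv; unfold schedule_inv in Hinv.
  destruct (estate K dl T) as [[[M sg] s] D] eqn:E.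
  rewrite (epoch_estate K dl T M sg s D E).
  destruct Hinv as [_ [_ [_ [HM | [m' [-> Hleft]]]]]].
  - rewrite HM; cbn [sumR]; rewrite Nat.leb_refl, sumR_0, Rplus_0_l.
    + destruct (first_epoch_bound K dl hK) as [-> | Hb].
      (* [3 * sqrt 2 <= 5] is the origin of the additive 5. *)
      * assert (sqrt (omega 1) <= 5 / 3); [|lra].
        unfold omega; rewrite pow_1.
        rewrite <- (sqrt_square (5 / 3)) by lra; apply sqrt_le_1_alt; lra.
      (* Here [3 * sqrt omega <= 3 * omega <= 6 e K ln K], within the additive [10 e^2 K ln K]. *)
      * pose proof (sqrt_omega_le (epoch K dl 1)).
        assert (exp 1 * INR K * ln (INR K) <= exp 1 ^ 2 * (INR K * ln (INR K)))
          by (rewrite Rmult_assoc; apply Rmult_le_compat_r; nra).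
        lra.
    + intros i Hi; destruct (Nat.leb_spec (epoch K dl 1) i); [lia | reflexivity].
  - pose proof (left_by_tradeoff K T m' dl beta hK Hbeta Hleft).
    pose proof (sum_sqrt_omega_le m').
    assert (sumR (S (S m')) (fun m => if (epoch K dl 1 <=? m)%nat
        then 3 * sqrt (omega m) else 0)
      <= 3 * sumR (S (S m')) (fun m => sqrt (omega m))).
    { rewrite <- sumR_scal; apply sumR_le; intros m _; pose proof (sqrt_pos (omega m)).
      destruct (epoch K dl 1 <=? m)%nat; lra. }
    lra.
Qed.
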